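(* Let $k\ge1$ and let $G$ be the graph consisting of the graph $Q_4(M)$ with $m_{ij}=k$ for all $1\le i<j\le4$, together with $k$ additional vertices $v_1,\dots,v_k$ such that for each $1\le i\le k$ the vertex set $\{1,2,3,v_i\}$ spans a complete graph (i.e. $v_i$ is adjacent exactly to $1,2,3$). Then the graphic arrangement $\mathcal{A}_G$ is $(k+1)$-coaccurate but not $k$-coaccurate.
   Context: Let $\mathbb{K}$ be a field. For a simple graph $G$ with vertices $v_1,\dots,v_n$, the graphic arrangement in $\mathbb{K}^n$ is $\mathcal{A}_G=\{\ker(x_i-x_j):\{v_i,v_j\}\text{ an edge}\}$. $Q_4(M)$ is the complete graph on $\{1,2,3,4\}$ together with, for each pair $i<j$, $m_{ij}$ new vertices each adjacent exactly to $i$ and $j$. For a central arrangement $\mathcal{A}$ in $V=\mathbb{K}^n$: $L(\mathcal{A})$ is the set of intersections of subsets of $\mathcal{A}$ (including $V$); $\mathcal{A}^X=\{H\cap X:H\in\mathcal{A},X\not\subseteq H\}$; $\mathcal{A}$ is free if $D(\mathcal{A})=\{\theta\in\mathrm{Der}(S):\theta(\alpha_H)\in\alpha_HS\ \forall H\}$ is free over $S=\mathbb{K}[x_1,\dots,x_n]$, exponents being degrees of a homogeneous basis. If $\mathcal{A}$ is free with exponents $e_1\le\dots\le e_n$, a witness for accuracy is a tuple $(X_1,\dots,X_n)$ of flats in $L(\mathcal{A})$ with $\dim X_d=d$ and $\mathcal{A}^{X_d}$ free with exponents $(e_1,\dots,e_d)$ for each $d$. For $1\le j\le n-1$, $\mathcal{A}$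 is $j$-coaccurate if there is a witness for accuracy with $X_1\subseteq X_2\subseteq\dots\subseteq X_{n-j}$ (so $j$-coaccurate implies $(j+1)$-coaccurate, and $1$-coaccurate means flag-accurate). *)

(* Defs.v *)
From HB Require Import structures.
From mathcomp Require Import all_boot all_order all_algebra.
From mathcomp Require Import finmap.
From mathcomp Require Import mpoly.

Set Implicit Arguments.
Unset Strict Implicit.
Unset Printing Implicit Defensive.

Import GRing.Theory.
Local Open Scope ring_scope.

Section Arrangements.
Context {K : fieldType} {V : vectType K}.

(* An arrangement in a subspace X of V is a finite set of subspaces of V that
   are hyperplanes of X; the coordinate ring Sym(X^* ) is identified with
   K[x_1, ..., x_n] through a basis b of X. [lform b a] is then the linear
   polynomial representing the restriction to X of the linear form a. *)
Definition lform n (b : n.-tuple V) (a : 'Hom(V, K^o)) : {mpoly K[n]} :=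
  \sum_(i < n) (a (tnth b i) : K) *: 'X_i.

Definition derivation n (theta : {mpoly K[n]} -> {mpoly K[n]}) : Prop :=
  linear theta /\ forall p q, theta (p * q) = theta p * q + p * theta q.

(* D(A); as a form defining H in X is determined up to a nonzero scalar, all
   of them are allowed for alpha_H. *)
Definition log_derivation n (b : n.-tuple V) (A : {fset {vspace V}})
    (theta : {mpoly K[n]} -> {mpoly K[n]}) : Prop :=
  derivation theta /\
  forall (H : {vspace V}) (a : 'Hom(V, K^o)), H \in A ->
    (lker a :&: <<b>>)%VS = H ->
    exists q, theta (lform b a) = lform b a * q.

Definition free_with_exponents n (b : n.-tuple V) (A : {fset {vspace V}})
    (e : seq nat) : Prop :=
  exists theta : 'I_(size e) -> {mpoly K[n]} -> {mpoly K[n]},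
    [/\ forall i, log_derivation b A (theta i),
        forall i j, theta i 'X_j \is (nth 0%N e i).-homog
      & forall eta, log_derivation b A eta ->
          exists! c : {ffun 'I_(size e) -> {mpoly K[n]}},
            forall p, eta p = \sum_i c i * theta i p].

Definition flat (A : {fset {vspace V}}) (X : {vspace V}) : Prop :=
  exists2 B : {fset {vspace V}}, (B `<=` A)%fset & X = (\bigcap_(H <- B) H)%VS.

Definition restriction (A : {fset {vspace V}}) (X : {vspace V}) :
    {fset {vspace V}} :=
  [fset (H :&: X)%VS | H in A & ~~ (X <= H)%VS]%fset.

End Arrangements.

Section Coaccuracy.
Context {K : fieldType} {n : nat}.

Definition std_basis : n.-tuple 'rV[K]_n := [tuple delta_mx 0 i | i < n].

(* X d stands for X_d, 1 <= d <= n; the other values of X are irrelevant. *)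
Definition accuracy_witness (A : {fset {vspace 'rV[K]_n}}) (e : seq nat)
    (X : nat -> {vspace 'rV[K]_n}) : Prop :=
  forall d, (1 <= d <= n)%N ->
    [/\ flat A (X d), \dim (X d) = d
      & free_with_exponents (vbasis (X d)) (restriction A (X d)) (take d e)].

Definition coaccurate (j : nat) (A : {fset {vspace 'rV[K]_n}}) : Prop :=
  exists (e : seq nat) (X : nat -> {vspace 'rV[K]_n}),
    [/\ free_with_exponents std_basis A e, sorted leq e,
        accuracy_witness A e X
      & forall c d, (1 <= c <= d)%N -> (d <= n - j)%N -> (X c <= X d)%VS].

Definition diag_hyperplane (i j : 'I_n) : {vspace 'rV[K]_n} :=
  lker (linfun (fun x : 'rV[K]_n => x 0 i - x 0 j : K^o)).

End Coaccuracy.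

Definition graphic_arrangement (K : fieldType) (T : finType) (edge : rel T) :
    {fset {vspace 'rV[K]_#|T|}} :=
  [fset diag_hyperplane (enum_rank p.1) (enum_rank p.2)
     | p : T * T in [pred p : T * T | edge p.1 p.2]]%fset.

(* The vertices 1, 2, 3, 4 are the elements 0, 1, 2, 3 of 'I_4; the vertex
   [inr (Tagged _ s)] with tag (i, j), i < j, is the s-th of the m_ij new
   vertices adjacent to i and j. *)
Definition Q4_vertex (M : 'I_4 -> 'I_4 -> nat) : finType :=
  ('I_4 + {p : {p : 'I_4 * 'I_4 | (p.1 < p.2)%N} &
             'I_(M (val p).1 (val p).2)})%type.

Definition Q4_edge (M : 'I_4 -> 'I_4 -> nat) : rel (Q4_vertex M) :=
  fun u v =>
    match u, v with
    | inl i, inl j => i != j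
    | inl i, inr w | inr w, inl i =>
        (i == (val (tag w)).1) || (i == (val (tag w)).2)
    | inr _, inr _ => false
    end.

Definition G_vertex (k : nat) : finType :=
  (Q4_vertex (fun _ _ => k) + 'I_k)%type.

Definition G_edge (k : nat) : rel (G_vertex k) :=
  fun u v =>
    match u, v with
    | inl a, inl b => Q4_edge a b
    | inl a, inr _ | inr _, inl a =>
        if a is inl i then (i < 3)%N else false
    | inr _, inr _ => false
    end.

(* Main.v *)
From HB Require Import structures.
Require Import Defs.
From mathcomp Require Import all_boot all_order all_fingroup all_algebra.
From mathcomp Require Import finmap mpoly zify.

(* G is a split graph: the core {1, 2, 3, 4} is a clique and every other vertex
   is adjacent to core vertices only. A flat X of A_G is given by an idempotent
   map r on the vertices, sending each vertex to a representative of its class,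
   which is a core vertex unless the class is a singleton. The restriction to X
   is again the arrangement of a split graph, and it is free with an explicit
   triangular basis: if y_0, ..., y_(c-1) are the core coordinates, take the
   derivations y |-> (y - y_0) ... (y - y_(p-1)) for p < c, and, for each
   noncore vertex w, the product of the y_w - y_u over the neighbours u of w,
   times d/dy_w. So the exponents are 0, ..., c - 1 and the degrees of the
   noncore vertices, and exponents are unique up to order.

   The exponents of A_G are 0, 1, 2^(6k+1), 3^(k+1). Contracting {1, 2} and the
   k vertices attached to this edge leaves a triangle with 6k vertices attached
   to its edges, with exponents 0, 1, 2^(6k+1), below which a flag is easily
   continued; this proves (k+1)-coaccuracy.

   Conversely, let Z be a flat of dimension 6k+3 contained in a flat Y of
   dimension 6k+4. As 3 is not an exponent of Z, two core vertices i, j are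
   identified in Z; as 1 is a simple exponent, the k vertices attached to the
   edge ij, which would have degree 1, are identified with them; and the
   dimension allows no other identification. In Y, either i and j are identified
   and one of these k vertices has degree 1, or the whole core and v_1, ..., v_k
   survive and 3 is an exponent at least k + 1 times. Both are impossible. *)

Set Implicit Arguments.
Unset Strict Implicit.
Unset Printing Implicit Defensive.

Import GRing.Theory.
Local Open Scope ring_scope.

(** * Derivations of a polynomial ring and their values on the variables *)

Section Derivations.
Context {K : fieldType} {n : nat}.
Implicit Types (p q : {mpoly K[n]}) (theta : {mpoly K[n]} -> {mpoly K[n]}).

Lemma mpoly_ring_ind (P : {mpoly K[n]} -> Prop) :
  (forall c, P c%:MP) -> (forall i, P 'X_i) ->
  (forall p q, P p -> P q -> P (p + q)) ->
  (forall p q, P p -> P q -> P (p * q)) -> forall p, P p.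
Proof.
move=> PC PX PD PM; elim/mpolyind=> [|c m p _ _ Pp]; first by rewrite -mpolyC0.
apply: (PD) => //; rewrite -mul_mpolyC; apply: (PM) => //; rewrite mpolyXE_id.
elim/big_ind: _ => [||i _]; [by rewrite -mpolyC1 | exact: PM |].
elim: (m i) => [|k IHk]; first by rewrite expr0 -mpolyC1.
by rewrite exprS; apply: (PM).
Qed.

Lemma derivationC theta c : derivation theta -> theta c%:MP = 0.
Proof.
case=> tlin tM; have /(congr1 (fun x => x - theta 1)) := tM 1 1.
rewrite !mul1r mulr1 subrr addrK => /esym t1.
have t0 : theta 0 = 0.
  by have /(congr1 (fun x => x - theta 0)) := tlin 1 0 0;
    rewrite scaler0 addr0 scale1r subrr addrK.
by have := tlin c 1 0; rewrite t1 t0 scaler0 !addr0 -alg_mpolyC.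
Qed.

Lemma derivationD theta p q :
  derivation theta -> theta (p + q) = theta p + theta q.
Proof. by case=> tlin _; have := tlin 1 p q; rewrite !scale1r. Qed.

Lemma derivationB theta p q :
  derivation theta -> theta (p - q) = theta p - theta q.
Proof.
move=> td; rewrite -{2}(subrK q p) (derivationD (p - q)) //.
by rewrite addrK.
Qed.

Lemma derivationZ theta c p : derivation theta -> theta (c *: p) = c *: theta p.
Proof.
by move=> td; rewrite -mul_mpolyC td.2 derivationC // mul0r add0r mul_mpolyC.
Qed.

(** The operator with coefficient [f j] on the [j]-th partial derivative. Its values on the
    variables can be prescribed freely, so derivations may be handled as tuples of polynomials. *)
Definition der_of (f : 'I_n -> {mpoly K[n]}) p : {mpoly K[n]} :=
  \sum_(j < n) f j * p^`M(j).

Lemma der_ofX f i : der_of f 'X_i = f i.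
Proof.
rewrite /der_of (bigD1 i) //= big1 ?addr0 => [|j ji]; rewrite mderivX mnm1E.
  by rewrite eqxx -{1}[U_(i)%MM]add0m addmK mpolyX0 scale1r mulr1.
by rewrite eq_sym (negbTE ji) scale0r mulr0.
Qed.

Lemma der_of_derivation f : derivation (der_of f).
Proof.
split=> [a p q | p q]; rewrite /der_of.
  rewrite scaler_sumr -big_split; apply: eq_bigr => j _ /=.
  by rewrite mderivD mderivZ mulrDr scalerAr.
rewrite mulr_suml mulr_sumr -big_split; apply: eq_bigr => j _ /=.
by rewrite mderivM mulrDr !mulrA [p * f j]mulrC.
Qed.

Lemma derivation_ext theta eta : derivation theta -> derivation eta ->
  (forall i, theta 'X_i = eta 'X_i) -> theta =1 eta.
Proof.
move=> td ed eqX; elim/mpoly_ring_ind => [c|//|p q Ep Eq|p q Ep Eq].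
- by rewrite !derivationC.
- by rewrite !derivationD // Ep Eq.
- by rewrite td.2 ed.2 Ep Eq.
Qed.

Lemma derivation_comb m (theta : 'I_m -> {mpoly K[n]} -> {mpoly K[n]})
    (c : 'I_m -> {mpoly K[n]}) : (forall i, derivation (theta i)) ->
  derivation (fun p => \sum_i c i * theta i p).
Proof.
move=> td; split=> [a p q | p q].
  rewrite scaler_sumr -big_split; apply: eq_bigr => j _ /=.
  by rewrite derivationD // derivationZ // mulrDr scalerAr.
rewrite mulr_suml mulr_sumr -big_split; apply: eq_bigr => j _ /=.
by rewrite (td j).2 mulrDr !mulrA [p * c j]mulrC.
Qed.

End Derivations.

(** * Divisibility by differences of variables *)

Section DiagonalDivisibility.
Context {K : fieldType} {n : nat}.
Implicit Types (p q : {mpoly K[n]}) (i j : 'I_n).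

(** Setting ['X_i] to ['X_j] realises the quotient by ['X_i - 'X_j]: divisibility becomes vanishing
    under a ring morphism. *)
Definition msubst i j p : {mpoly K[n]} :=
  p \mPo [tuple if l == i then 'X_j else 'X_l | l < n].

HB.instance Definition _ i j := GRing.RMorphism.copy (msubst i j) (msubst i j).

Lemma msubstX i j l : msubst i j 'X_l = if l == i then 'X_j else 'X_l.
Proof. by rewrite /msubst comp_mpolyXU -tnth_nth tnth_mktuple. Qed.

Lemma msubstC i j c : msubst i j c%:MP = c%:MP.
Proof. exact: comp_mpolyC. Qed.

Lemma msubst_sub i j p : exists q, p - msubst i j p = ('X_i - 'X_j) * q.
Proof.
move: p; apply: (@mpoly_ring_ind K n) => [c|l|p q [u Hu] [v Hv]|p q [u Hu] [v Hv]].
- by exists 0; rewrite msubstC subrr mulr0.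
- rewrite msubstX; case: eqP => [->|_]; first by exists 1; rewrite mulr1.
  by exists 0; rewrite subrr mulr0.
- by exists (u + v); rewrite rmorphD /= mulrDr -Hu -Hv opprD addrACA.
- exists (u * q + msubst i j p * v).
  rewrite rmorphM /= mulrDr mulrA -Hu mulrCA -Hv mulrBl mulrBr.
  by rewrite addrA subrK.
Qed.

Lemma dvd_diagP i j p :
  (exists q, p = ('X_i - 'X_j) * q) <-> msubst i j p = 0.
Proof.
split=> [[q ->]|p0]; last by have := msubst_sub i j p; rewrite p0 subr0.
rewrite rmorphM rmorphB /= !msubstX eqxx.
by case: eqP => _; rewrite subrr mul0r.
Qed.

Lemma mpolyX_sub_neq0 i j : i != j -> 'X_i - 'X_j != 0 :> {mpoly K[n]}.
Proof.
move=> ij; apply/eqP => /(congr1 (mcoeff U_(i))); rewrite mcoeffB !mcoeffX eqxx.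
by rewrite eq_mnm1 eq_sym (negbTE ij) subr0 mcoeff0 => /eqP; rewrite oner_eq0.
Qed.

(** The substitution for [j] turns every other factor ['X_i - 'X_l] into the nonzero ['X_j - 'X_l];
    in a domain it is then the cofactor that vanishes, and it splits off ['X_i - 'X_j]. *)
Lemma dvd_diag_prod i (A : {set 'I_n}) p : i \notin A ->
  (forall j, j \in A -> msubst i j p = 0) ->
  exists q, p = q * \prod_(j in A) ('X_i - 'X_j).
Proof.
rewrite -mem_enum -big_enum /= => iA pA.
have {}pA j : j \in enum A -> msubst i j p = 0 by rewrite mem_enum => /pA.
elim: (enum A) (enum_uniq A) iA pA => [|j s IHs] /=.
  by move=> _ _ _; exists p; rewrite big_nil mulr1.
case/andP=> js us; rewrite inE negb_or => /andP[ij si] pA.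
have [l ls|q Hq] := IHs us si; first by apply: pA; rewrite inE ls orbT.
have := pA j (mem_head _ _); rewrite {1}Hq rmorphM rmorph_prod /= => /eqP.
rewrite mulf_eq0 prodf_seq_eq0 => /orP[/eqP/dvd_diagP[r Hr]|/hasP[l ls /=]].
  by exists r; rewrite big_cons Hq Hr mulrA [r * _]mulrC.
rewrite rmorphB /= !msubstX eqxx.
have -> : (l == i) = false by apply: contraNF si => /eqP <-.
rewrite (negbTE (mpolyX_sub_neq0 _)) //.
by apply: contraNneq js => ->.
Qed.

End DiagonalDivisibility.

(** * The triangular basis of value tuples for a split graph *)

Section NewtonBasis.
Context {K : fieldType} {n : nat} (c : nat) (nb : 'I_n -> {set 'I_n}).
Hypothesis nb_core : forall i : 'I_n, (i < c)%N -> nb i = [set j : 'I_n | (j < i)%N].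
Hypothesis nb_free : forall i j : 'I_n, (c <= i)%N -> j \in nb i -> (j < c)%N.

(** The logarithmic condition expressed on the values at the variables; each edge is recorded once,
    at its larger endpoint. *)
Definition log_values (f : 'I_n -> {mpoly K[n]}) : Prop :=
  forall i j, j \in nb i -> msubst i j (f i - f j) = 0.

(** Entry [l] is the value at ['X_l]. For core [i], Newton's interpolation polynomial with nodes
    ['X_0, ..., 'X_(i-1)] is evaluated at every coordinate; for noncore [i], only entry [i] is
    nonzero. *)
Definition newton (i l : 'I_n) : {mpoly K[n]} :=
  if (i < c)%N || (l == i) then \prod_(j in nb i) ('X_l - 'X_j) else 0.

Lemma nb_lt i j : j \in nb i -> (j < i)%N.
Proof.
have [ic|ic] := ltnP i c; first by rewrite nb_core // inE.
by move=> /(nb_free ic) jc; apply: leq_trans ic.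
Qed.

(** For core [i] both entries are one polynomial evaluated at variables that the substitution
    identifies. A noncore [i] is nobody's entry in [nb], and its own entry contains the factor that
    the substitution kills. *)
Lemma newton_log i : log_values (newton i).
Proof.
move=> l l' ll'; rewrite /newton.
have l'l : (l' == l) = false by rewrite -val_eqE ltn_eqF // nb_lt.
have [ic|ic] /= := ltnP i c.
  rewrite rmorphB !rmorph_prod /=; apply/eqP; rewrite subr_eq0; apply/eqP.
  by apply: eq_bigr => j _; rewrite !rmorphB /= !msubstX eqxx l'l.
have [eli|nli] := eqVneq l i; last first.
  case: eqP => [l'i|_]; last by rewrite subrr rmorph0.
  have := nb_lt ll'; rewrite l'i => il.
  by have := nb_free (leq_trans ic (ltnW il)) ll'; rewrite l'i ltnNge ic.
rewrite -eli l'l subr0 rmorph_prod /= (bigD1 l') //= rmorphB /= !msubstX.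
by rewrite eqxx l'l subrr mul0r.
Qed.

Lemma newton_lt (i l : 'I_n) : (l < i)%N -> newton i l = 0.
Proof.
move=> li; rewrite /newton -val_eqE (ltn_eqF li) orbF; case: ifP => // ic.
by rewrite nb_core // (bigD1 l) ?inE //= subrr mul0r.
Qed.

Lemma newton_diag i : newton i i = \prod_(j in nb i) ('X_i - 'X_j).
Proof. by rewrite /newton eqxx orbT. Qed.

Lemma newton_diag_neq0 i : newton i i != 0.
Proof.
rewrite newton_diag; apply/prodf_neq0 => j /nb_lt ji.
by apply: mpolyX_sub_neq0; rewrite -val_eqE gtn_eqF.
Qed.

Lemma newton_homog i l : newton i l \is #|nb i|.-homog.
Proof.
rewrite /newton; case: ifP => _; last exact: dhomog0.
rewrite -sum1_card; elim/big_rec2: _ => [|j m p _ hp]; first exact: dhomog1.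
apply: dhomogM => //; apply: rpredB; rewrite dhomogX; apply/eqP/mdeg1.
Qed.

Lemma newton_span f : log_values f ->
  exists a : {ffun 'I_n -> {mpoly K[n]}}, forall l, f l = \sum_i a i * newton i l.
Proof.
move=> flog.
suff H : forall m, (m <= n)%N -> exists a : {ffun 'I_n -> {mpoly K[n]}},
    forall l : 'I_n, (l < m)%N -> f l = \sum_i a i * newton i l.
  by have [a Ha] := H n (leqnn n); exists a => l; apply: Ha.
elim=> [|m IHm] mn; first by exists [ffun=> 0].
have [a Ha] := IHm (ltnW mn); pose k := Ordinal mn.
(* The remainder [g] is again logarithmic and vanishes below [k], so [g k] is a multiple of
   [newton k k]. Adding the quotient to coefficient [k] leaves the earlier coordinates unchanged. *)
pose g l := f l - \sum_i a i * newton i l.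
have glog : log_values g.
  move=> i j ij; have -> : g i - g j =
      (f i - f j) - \sum_l a l * (newton l i - newton l j).
    rewrite /g opprD opprK addrACA; congr (_ + _).
    rewrite -!sumrN -big_split /=; apply: eq_bigr => l _.
    by rewrite mulrBr opprB addrC.
  rewrite rmorphB rmorph_sum /= flog // big1 ?subr0 // => l _.
  by rewrite rmorphM /= newton_log // mulr0.
have [|j kj|q Hq] := @dvd_diag_prod _ _ k (nb k) (g k).
- by apply/negP => /nb_lt; rewrite ltnn.
- have := glog _ _ kj; rewrite {2}/g Ha ?subrr ?subr0 //; exact: nb_lt kj.
exists [ffun i => a i + (if i == k then q else 0)] => l lm.
have -> : \sum_i [ffun i => a i + (if i == k then q else 0)] i * newton i l
        = \sum_i a i * newton i l + q * newton k l.
  rewrite (eq_bigr (fun i => a i * newton i l +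
    (if i == k then q else 0) * newton i l)); last first.
    by move=> i _; rewrite ffunE mulrDl.
  rewrite big_split /=; congr (_ + _).
  rewrite (bigD1 k) //= eqxx big1 ?addr0 // => i /negbTE->.
  by rewrite mul0r.
move: lm; rewrite ltnS leq_eqVlt => /orP[/eqP lm|lm]; last first.
  by rewrite (@newton_lt k) // mulr0 addr0 Ha.
have -> : l = k by apply: val_inj.
by rewrite newton_diag -Hq /g addrC subrK.
Qed.

Lemma newton_independent (a : 'I_n -> {mpoly K[n]}) :
  (forall l, \sum_i a i * newton i l = 0) -> forall i, a i = 0.
Proof.
move=> a0 i; have [m] := ubnP (val i); elim: m i => // m IHm i im.
have := a0 i; rewrite (bigD1 i) //= big1 ?addr0 => [|j ji].
  by move/eqP; rewrite mulf_eq0 (negbTE (newton_diag_neq0 i)) orbF => /eqP.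
have [ij|] := ltnP i j; first by rewrite newton_lt // mulr0.
rewrite leq_eqVlt val_eqE (negbTE ji) => /= ji'.
by rewrite IHm ?mul0r // (leq_trans ji').
Qed.

Lemma newton_basis f : log_values f ->
  exists! a : {ffun 'I_n -> {mpoly K[n]}}, forall l, f l = \sum_i a i * newton i l.
Proof.
move=> /newton_span[a Ha]; exists a; split=> // b Hb; apply/ffunP => i.
apply/eqP; rewrite -subr_eq0; apply/eqP.
apply: (newton_independent (a := fun i => a i - b i)) => l.
under eq_bigr do rewrite mulrBl.
by rewrite sumrB -Ha -Hb subrr.
Qed.

End NewtonBasis.

(** * Reordering the exponents *)

Section LogBases.
Context {K : fieldType} {V : vectType K} {n : nat}.
Implicit Types (b : n.-tuple V) (A : {fset {vspace V}}).

(** Freeness with an index type independent of [size e], so that bases of different order or length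
    can be compared without casts. *)
Definition log_basis m b A (e : 'I_m -> nat)
    (theta : 'I_m -> {mpoly K[n]} -> {mpoly K[n]}) : Prop :=
  [/\ forall i, log_derivation b A (theta i),
      forall i j, theta i 'X_j \is (e i).-homog
    & forall eta, log_derivation b A eta ->
        exists! c : {ffun 'I_m -> {mpoly K[n]}},
          forall p, eta p = \sum_i c i * theta i p].

Lemma free_with_exponentsP m b A (e : m.-tuple nat) :
  free_with_exponents b A e <-> exists theta, log_basis b A (tnth e) theta.
Proof.
case: e => e sz; move: (sz); rewrite -(eqP sz) => sz'; rewrite /free_with_exponents.
split=> -[theta [tlog thom tbasis]]; exists theta; split=> // i j.
  by rewrite (tnth_nth 0%N).
by have := thom i j; rewrite (tnth_nth 0%N).
Qed.

Lemma free_with_exponents_perm b A e e' :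
  perm_eq e' e -> free_with_exponents b A e -> free_with_exponents b A e'.
Proof.
move=> pe; have sz : size e' == size e by rewrite (perm_size pe).
have /tuple_permP[s Hs] : perm_eq (Tuple sz) (in_tuple e) by [].
move=> /(free_with_exponentsP _ _ (in_tuple e))[theta [tlog thom tbasis]].
apply/(free_with_exponentsP _ _ (Tuple sz)); exists (fun i => theta (s i)).
split=> [i|i j|eta /tbasis[c [Hc Uc]]]; first exact: tlog.
  by have -> : tnth (Tuple sz) i = tnth (in_tuple e) (s i);
    [rewrite (tnth_nth 0%N) Hs -tnth_nth tnth_mktuple | exact: thom].
exists [ffun i => c (s i)]; split=> [p | c' Hc'].
  rewrite Hc (reindex_inj (@perm_inj _ s)) /=.
  by apply: eq_bigr => i _; rewrite ffunE.
apply/ffunP => i; rewrite ffunE.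
have -> : c = [ffun i => c' ((s^-1)%g i)].
  apply: Uc => p; rewrite Hc' (reindex_inj (@perm_inj _ (s^-1)%g)) /=.
  by apply: eq_bigr => j _; rewrite ffunE permKV.
by rewrite ffunE permK.
Qed.

End LogBases.

(** * Independence of the basis chosen for the flat *)

Section ChangeOfBasis.
Context {K : fieldType} {V : vectType K} {n : nat} (X : {vspace V}).
Implicit Types (b : n.-tuple V) (A : {fset {vspace V}}).

Definition coordform b (i : 'I_n) : 'Hom(V, K^o) :=
  linfun (coord b i : V -> K^o).

(** Rewrites a polynomial in the coordinates of [b'] in those of [b]; derivations are transported by
    conjugation. *)
Definition change_basis b b' (p : {mpoly K[n]}) : {mpoly K[n]} :=
  p \mPo [tuple lform b (coordform b' i) | i < n].

HB.instance Definition _ b b' := GRing.LRMorphism.copy (change_basis b b') (change_basis b b').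

Lemma change_lform b b' a : basis_of X b -> basis_of X b' ->
  change_basis b b' (lform b' a) = lform b a.
Proof.
move=> bX b'X; rewrite {1}/lform linear_sum /=.
under eq_bigr => i _.
  rewrite linearZ /= {1}/change_basis comp_mpolyXU -tnth_nth tnth_mktuple.
  rewrite /lform scaler_sumr.
  under eq_bigr do rewrite scalerA lfunE /=.
  over.
rewrite exchange_big; apply: eq_bigr => l _ /=; rewrite -scaler_suml.
congr (_ *: _); have bl : tnth b l \in X by rewrite -(span_basis bX) memv_span ?mem_tnth.
rewrite [in RHS](coord_basis b'X bl) linear_sum /=.
apply: eq_bigr => i _; rewrite linearZ /= -tnth_nth mulrC.
by [].
Qed.

Lemma change_X b b' i : change_basis b b' 'X_i = lform b (coordform b' i).
Proof. by rewrite /change_basis comp_mpolyXU -tnth_nth tnth_mktuple. Qed.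

Lemma lform_coordform b i : basis_of X b -> lform b (coordform b i) = 'X_i.
Proof.
move=> bX; rewrite /lform (bigD1 i) //= big1 ?addr0 => [|j ji].
  by rewrite lfunE /= (tnth_nth 0) coord_free ?eqxx ?scale1r ?(basis_free bX).
rewrite lfunE /= (tnth_nth 0) coord_free ?(basis_free bX) //.
by rewrite (negbTE ji) scale0r.
Qed.

Lemma changeK b b' p : basis_of X b -> basis_of X b' ->
  change_basis b b' (change_basis b' b p) = p.
Proof.
move=> bX b'X; move: p.
apply: (@mpoly_ring_ind K n) => [c|i|p q Ep Eq|p q Ep Eq].
- by rewrite /change_basis !comp_mpolyC.
- by rewrite change_X change_lform // lform_coordform.
- by rewrite !rmorphD /= Ep Eq.
- by rewrite !rmorphM /= Ep Eq.
Qed.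

Lemma lform_homog b a : lform b a \is 1.-homog.
Proof. by apply: rpred_sum => i _; apply: rpredZ; rewrite dhomogX; apply/eqP/mdeg1. Qed.

Lemma change_homog b b' d p : p \is d.-homog -> change_basis b b' p \is d.-homog.
Proof.
move=> /dhomogP hp; rewrite /change_basis comp_mpolyE; rewrite big_seq.
apply: rpred_sum => m /hp; rewrite /= mdegE => <-; apply: rpredZ.
elim/big_rec2: _ => [|i e q _ hq]; first exact: dhomog1.
apply: dhomogM => //; rewrite tnth_mktuple -[e in e.-homog]mul1n.
exact/dhomogMn/lform_homog.
Qed.

Lemma derivation_change b b' theta : basis_of X b -> basis_of X b' ->
  derivation theta -> derivation (fun p => change_basis b' b (theta (change_basis b b' p))).
Proof.
move=> bX b'X td; split=> [a p q|p q].
  by rewrite linearP derivationD // derivationZ // linearP.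
by rewrite rmorphM /= td.2 rmorphD !rmorphM /= !changeK.
Qed.

Lemma log_derivation_change b b' A theta : basis_of X b -> basis_of X b' ->
  log_derivation b A theta ->
  log_derivation b' A (fun p => change_basis b' b (theta (change_basis b b' p))).
Proof.
move=> bX b'X [td tlog]; split; first exact: derivation_change.
move=> H a HA Ha; have [|q Hq] := tlog H a HA.
  by rewrite (span_basis bX) -(span_basis b'X).
by exists (change_basis b' b q); rewrite change_lform // Hq rmorphM /= change_lform.
Qed.

Lemma free_with_exponents_change b b' A e : basis_of X b -> basis_of X b' ->
  free_with_exponents b A e -> free_with_exponents b' A e.
Proof.
move=> bX b'X [theta [tlog thom tbasis]].
exists (fun i p => change_basis b' b (theta i (change_basis b b' p))).
split=> [i|i j|eta elog]; first exact: log_derivation_change.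
- rewrite change_X; apply: change_homog; rewrite /lform.
  have td := (tlog i).1; elim/big_rec: _ => [|l p _ hp].
    by rewrite -mpolyC0 derivationC // dhomog0.
  rewrite derivationD // derivationZ //.
  by apply: dhomogD => //; apply: dhomogZ.
have [c [Hc Uc]] := tbasis _ (log_derivation_change b'X bX elog).
exists [ffun i => change_basis b' b (c i)]; split=> [p|c' Hc'].
  have := congr1 (change_basis b' b) (Hc (change_basis b b' p)); rewrite !changeK // => ->.
  by rewrite rmorph_sum; apply: eq_bigr => i _; rewrite rmorphM ffunE.
have -> : c = [ffun i => change_basis b b' (c' i)].
  apply: Uc => p; rewrite Hc' rmorph_sum /=.
  by apply: eq_bigr => i _; rewrite rmorphM /= !changeK // ffunE.
by apply/ffunP => i; rewrite !ffunE changeK.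
Qed.

End ChangeOfBasis.

Lemma free_with_exponents_basis (K : fieldType) (V : vectType K) n m
    (X : {vspace V}) (b : n.-tuple V) (b' : m.-tuple V) A e :
  basis_of X b -> basis_of X b' ->
  free_with_exponents b A e -> free_with_exponents b' A e.
Proof.
move=> bX b'X; have nm : n = m.
  by rewrite -(@vector.size_basis _ _ _ _ b bX) -(@vector.size_basis _ _ _ _ b' b'X).
case: m / nm b' b'X => b' b'X; exact: free_with_exponents_change bX b'X.
Qed.

(** * Uniqueness of exponents up to order *)

Section ExponentsUnique.
Context {K : fieldType} {V : vectType K} {n : nat}.
Implicit Types (b : n.-tuple V) (A : {fset {vspace V}}) (p q : {mpoly K[n]}).

(** The test [e <= d] matters: for [d < e] the truncated [d - e] would select the constant part of
    [p]. *)
Lemma pihomogM_homog d e p q : q \is e.-homog ->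
  pihomog mdeg d (p * q) = (if (e <= d)%N then pihomog mdeg (d - e) p else 0) * q.
Proof.
move=> qe; elim/mpolyind: p => [|c m p _ _ IHp].
  by rewrite mul0r !pihomog0; case: ifP; rewrite mul0r.
rewrite mulrDl pihomogD IHp -scalerAl linearZ /=.
have Xq : 'X_[m] * q \is (mdeg m + e).-homog by rewrite dhomogM ?dhomogX.
have [dme|dme] := eqVneq (mdeg m + e)%N d.
  rewrite -dme leq_addl addnK pihomog_dE //.
  by rewrite pihomogD linearZ /= pihomogX eqxx mulrDl scalerAl.
rewrite (pihomog_ne0 dme Xq) scaler0 add0r.
case: (leqP e d) => // ed; rewrite pihomogD linearZ /= pihomogX.
have /negbTE-> : mdeg m != (d - e)%N.
  by apply: contraNneq dme => ->; rewrite subnK.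
by rewrite scaler0 add0r.
Qed.

(** The common value of the two expansions is itself a logarithmic derivation, so the uniqueness
    clause applies to it. *)
Lemma log_basis_inj m b A (e : 'I_m -> nat) theta (c c' : {ffun 'I_m -> {mpoly K[n]}}) :
  log_basis b A e theta ->
  (forall p, \sum_i c i * theta i p = \sum_i c' i * theta i p) -> c = c'.
Proof.
case=> tlog _ tbasis Ec; have [|a [_ Ua]] := tbasis (fun p => \sum_i c i * theta i p).
  split; first by apply: derivation_comb => i; case: (tlog i).
  move=> H f HA Hf; have tl i := (tlog i).2 H f HA Hf.
  have [u Hu] : exists u : 'I_m -> _,
      forall i, theta i (lform b f) = lform b f * u i.
    by have [u Hu] := fin_all_exists tl; exists u.
  exists (\sum_i c i * u i); rewrite mulr_sumr; apply: eq_bigr => i _.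
  by rewrite Hu mulrCA.
by rewrite -(Ua c) // -(Ua c').
Qed.

(* Only the homogeneous part of degree [d - e i] of [c i] contributes to the
   degree [d] part of the expansion, so by uniqueness [c i] is homogeneous. *)
Lemma log_basis_coef0 m b A (e : 'I_m -> nat) theta eta d
    (c : {ffun 'I_m -> {mpoly K[n]}}) :
  log_basis b A e theta -> derivation eta -> (forall j, eta 'X_j \is d.-homog) ->
  (forall p, eta p = \sum_i c i * theta i p) ->
  forall i, (c i)@_0 != 0 -> e i = d.
Proof.
move=> tb ed ehom Hc i.
pose c' := [ffun i => if (e i <= d)%N then pihomog mdeg (d - e i) (c i) else 0].
have td l : derivation (theta l) by case: tb => tlog _ _; case: (tlog l).
have -> : c = c'.
  apply: (log_basis_inj tb) => p; rewrite -Hc; move: p.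
  apply: derivation_ext => //; first exact: derivation_comb.
  move=> j; rewrite -[LHS](pihomog_dE (ehom j)) Hc linear_sum /=.
  by apply: eq_bigr => l _; rewrite ffunE (@pihomogM_homog _ (e l)) //; case: tb.
rewrite ffunE; case: leqP => ei; last by rewrite mcoeff0 eqxx.
have [de0|de0] := eqVneq (d - e i)%N 0%N.
  by move=> _; apply/eqP; rewrite eqn_leq ei -subn_eq0 de0.
rewrite (dhomog_nemf_coeff (pihomogP _ _ _)) ?eqxx //=.
by rewrite mdeg0 eq_sym.
Qed.

Lemma log_basis_mx m m' b A (e : 'I_m -> nat) (e' : 'I_m' -> nat) theta theta' :
  log_basis b A e theta -> log_basis b A e' theta' ->
  exists C : 'I_m -> {ffun 'I_m' -> {mpoly K[n]}},
    (forall i p, theta i p = \sum_j C i j * theta' j p) /\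
    forall i j, (C i j)@_0 != 0 -> e' j = e i.
Proof.
move=> [tlog thom tb] tb'; have [_ _ ex'] := tb'.
have [C HC] : exists C : 'I_m -> {ffun 'I_m' -> {mpoly K[n]}},
    forall i p, theta i p = \sum_j C i j * theta' j p.
  have ex i : exists c : {ffun 'I_m' -> {mpoly K[n]}},
      forall p, theta i p = \sum_j c j * theta' j p.
    by have [c [Hc _]] := ex' _ (tlog i); exists c.
  by have [C HC] := fin_all_exists ex; exists C.
exists C; split=> // i j; apply: (log_basis_coef0 tb' _ (thom i) (HC i)).
by case: (tlog i).
Qed.

(** By uniqueness of expansions the polynomial transition matrices multiply to the identity, and
    taking constant terms is a ring morphism. *)
Lemma log_basis_mx_inv m m' b A (e : 'I_m -> nat) theta
    (theta' : 'I_m' -> {mpoly K[n]} -> {mpoly K[n]}) C D :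
  log_basis b A e theta ->
  (forall i p, theta i p = \sum_j (C i : {ffun _}) j * theta' j p) ->
  (forall j p, theta' j p = \sum_i (D j : {ffun _}) i * theta i p) ->
  (\matrix_(i, j) (C i j)@_0) *m (\matrix_(j, i) (D j i)@_0) = 1%:M.
Proof.
move=> tb HC HD; apply/matrixP => i l; rewrite !mxE.
have E : [ffun l => \sum_j C i j * D j l] = [ffun l => (i == l)%:R].
  apply: (log_basis_inj tb) => p.
  transitivity (theta i p); last first.
    rewrite (bigD1 i) //= big1 ?addr0 => [|j ji]; rewrite ffunE.
      by rewrite eqxx mul1r.
    by rewrite eq_sym (negbTE ji) mul0r.
  rewrite HC; under [RHS]eq_bigr do rewrite HD mulr_sumr.
  rewrite exchange_big; apply: eq_bigr => j _ /=.
  by rewrite ffunE mulr_suml; apply: eq_bigr => k _; rewrite mulrA.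
have /(congr1 (mcoeff 0)) := congr1 (fun f : {ffun _} => f l) E.
rewrite !ffunE rmorph_sum rmorph_nat /= => <-.
by apply: eq_bigr => j _; rewrite !mxE rmorphM.
Qed.

Lemma free_exponents_unique b A e e' :
  free_with_exponents b A e -> free_with_exponents b A e' -> perm_eq e e'.
Proof.
move=> /(free_with_exponentsP _ _ (in_tuple e))[theta tb].
move=> /(free_with_exponentsP _ _ (in_tuple e'))[theta' tb'].
have [C [HC C0]] := log_basis_mx tb tb'; have [D [HD _]] := log_basis_mx tb' tb.
have CD := log_basis_mx_inv tb HC HD; have DC := log_basis_mx_inv tb' HD HC.
have ee' : size e = size e'.
  by apply/eqP; rewrite eqn_leq (mulmx1_min CD) (mulmx1_min DC).
rewrite -[e]/(val (in_tuple e)) -[e']/(val (in_tuple e')).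
move: (in_tuple e) (in_tuple e') C C0 D CD {tb tb' HC HD DC theta theta'}.
case: _ / ee' => t t' C C0 D CD.
(* Some term of the permutation expansion of this determinant is nonzero; its permutation matches
   each exponent with an equal one. *)
have /eqP : \det (\matrix_(i, j) (C i j)@_0) != 0.
  by have [] := mulmx1_unit CD; rewrite unitmxE unitfE.
case: (pickP (fun s : 'S__ => \prod_i (C i (s i))@_0 != 0)) => [s /prodf_neq0 Hs _|Hs []].
  apply/tuple_permP; exists s; congr (val _); apply: eq_from_tnth => i.
  by rewrite tnth_mktuple (C0 _ _ (Hs i isT)).
rewrite /determinant big1 // => s _; under eq_bigr do rewrite mxE.
by have /negbFE/eqP-> := Hs s; rewrite mulr0.
Qed.

End ExponentsUnique.

(** * Diagonal hyperplanes and their linear forms *)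

Section Diagonals.
Context {K : fieldType} {n : nat}.
Implicit Types (i j : 'I_n) (x : 'rV[K]_n).

Definition diag_fun i j x : K^o := x 0 i - x 0 j.

Lemma diag_fun_linear i j : linear (diag_fun i j).
Proof. by move=> a x y; rewrite /diag_fun !mxE opprD addrACA -mulrBr. Qed.

HB.instance Definition _ i j :=
  GRing.isLinear.Build K 'rV[K]_n K^o _ (diag_fun i j) (diag_fun_linear i j).

Definition diag_form i j : 'Hom('rV[K]_n, K^o) := linfun (diag_fun i j).

Lemma diag_formE i j x : diag_form i j x = x 0 i - x 0 j.
Proof. exact: lfunE. Qed.

Lemma mem_diag i j x : (x \in diag_hyperplane i j) = (x 0 i == x 0 j).
Proof. by rewrite memv_ker -[linfun _]/(diag_form i j) diag_formE subr_eq0. Qed.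

End Diagonals.

(** * Freeness of the restriction to a contracted flat *)

Section Contractions.
Context {K : fieldType} {T : finType} (edge : rel T) (core : pred T).
Hypothesis edge_sym : ssrbool.symmetric edge.
Hypothesis core_complete : {in core &, forall u v, edge u v = (u != v)}.
Hypothesis noncore_independent : {in [predC core] &, forall u v, edge u v = false}.

Local Notation A := (graphic_arrangement K edge).
Local Notation rank := (@enum_rank T).

Lemma edge_irr u v : edge u v -> u != v.
Proof.
apply: contraTneq => ->; have [cv|cv] := boolP (v \in core).
  by rewrite core_complete // eqxx.
by rewrite noncore_independent.
Qed.

Lemma mem_graphic H :
  reflect (exists2 p : T * T, edge p.1 p.2 & H = diag_hyperplane (rank p.1) (rank p.2))
          (H \in A).
Proof. by apply: (iffP (imfsetP _ _ _ _)) => -[p Hp ->]; exists p. Qed.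

(* The retraction [r] sends a vertex to the representative of its class in a
   partition of the vertices in which every class of at least two vertices
   meets the core and is represented by a core vertex. *)
Definition contraction (r : T -> T) : Prop :=
  (forall u, r (r u) = r u) /\ (forall u, r u != u -> r u \in core).

Definition contr_space (r : T -> T) : {vspace 'rV[K]_#|T|} :=
  (\bigcap_u diag_hyperplane (rank u) (rank (r u)))%VS.

Lemma mem_contr_space r (x : 'rV[K]_#|T|) :
  reflect (forall u, x 0 (rank u) = x 0 (rank (r u))) (x \in contr_space r).
Proof.
rewrite /contr_space memvE.
apply: (iffP subv_bigcapP) => [H u|H u _].
  by have := H u isT; rewrite -memvE mem_diag => /eqP.
by rewrite -memvE mem_diag; apply/eqP.
Qed.

(** The image under [r] counts the degree after contraction: neighbours with a common representative
    yield the same hyperplane. *)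
Definition contr_exps (r : T -> T) : seq nat :=
  iota 0 #|[pred p in core | r p == p]| ++
  [seq #|r @: [set u | edge p u]| | p <- enum [pred p in [predC core] | r p == p]].

Section Free.
Variable r : T -> T.
Hypothesis r_contr : contraction r.

(** Core representatives are listed first, so that [i < c] tests for the core, as the Newton basis
    demands. *)
Let rc := enum [pred p in core | r p == p].
Let rn := enum [pred p in [predC core] | r p == p].
Let rs := rc ++ rn.
Let c := size rc.
Let m := size rs.
Let rho (i : 'I_m) : T := tnth (in_tuple rs) i.

Lemma contr_idem u : r (r u) = r u. Proof. by case: r_contr. Qed.

Lemma contr_core u : u \in core -> r u \in core.
Proof. by move=> cu; have [->|/r_contr.2] := eqVneq (r u) u. Qed.

Lemma contr_noncore u : r u \notin core -> r u = u.
Proof. by apply: contraNeq => /r_contr.2. Qed.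

Let mem_rs p : (p \in rs) = (r p == p).
Proof. by rewrite mem_cat !mem_enum !inE; case: (p \in core); rewrite ?orbF. Qed.

Let rs_uniq : uniq rs.
Proof.
rewrite cat_uniq !enum_uniq andbT; apply/hasPn => p.
by rewrite !mem_enum !inE => /andP[/negbTE /= ->].
Qed.

Let rho_inj : injective rho.
Proof. by apply/(tuple_uniqP (in_tuple rs)). Qed.

Let rho_fix i : r (rho i) = rho i.
Proof. by apply/eqP; rewrite -mem_rs mem_tnth. Qed.

Let rho_surj u : exists i, rho i = r u.
Proof.
have : r u \in in_tuple rs by rewrite mem_rs contr_idem.
by case/tnthP => i ->; exists i.
Qed.

Let rho_core i : (rho i \in core) = (i < c)%N.
Proof.
rewrite /rho (tnth_nth (rho i)) /= nth_cat -/c; case: ltnP => ic.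
  have : nth (rho i) rc i \in rc by rewrite mem_nth.
  by rewrite mem_enum !inE => /andP[].
apply/negbTE; have : nth (rho i) rn (i - c) \in rn.
  by rewrite mem_nth // -(ltn_add2r c) subnK // addnC -size_cat.
by rewrite mem_enum !inE => /andP[].
Qed.

(** The indicator vector of the class of [p]; the coordinates dual to these vectors are the entries
    at the representatives. *)
Let bvec (p : T) : 'rV[K]_#|T| := \row_i (r (enum_val i) == p)%:R.
Let b : m.-tuple 'rV[K]_#|T| := [tuple bvec (rho i) | i < m].

Let bvecE p u : bvec p 0 (rank u) = (r u == p)%:R.
Proof. by rewrite mxE enum_rankK. Qed.

Let bvec_in p : bvec p \in contr_space r.
Proof. by apply/mem_contr_space => u; rewrite !bvecE contr_idem. Qed.

Let b_expand x : x \in contr_space r ->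
  x = \sum_i x 0 (rank (rho i)) *: tnth b i.
Proof.
move=> /mem_contr_space xX; apply/rowP => l; rewrite -[l]enum_valK summxE.
have [i Hi] := rho_surj (enum_val l); rewrite xX (bigD1 i) //= big1 => [|j ji].
  by rewrite addr0 mxE tnth_mktuple bvecE Hi eqxx mulr1.
rewrite mxE tnth_mktuple bvecE -Hi eq_sym (inj_eq rho_inj) (negbTE ji).
by rewrite mulr0.
Qed.

Let b_basis : basis_of (contr_space r) b.
Proof.
rewrite basisEfree; apply/and3P; split.
- apply/freeP => k Hk i; have := congr1 (fun x : 'rV_ _ => x 0 (rank (rho i))) Hk.
  have bE (l : 'I_m) : b`_l = bvec (rho l) by rewrite -tnth_nth tnth_mktuple.
  rewrite summxE (bigD1 i) //= big1 => [|j ji]; rewrite mxE bE bvecE rho_fix.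
    by rewrite eqxx mulr1 addr0 mxE.
  by rewrite (inj_eq rho_inj) eq_sym (negbTE ji) mulr0.
- apply/span_subvP => x /tnthP[i ->]; rewrite tnth_mktuple; exact: bvec_in.
- have : (contr_space r <= <<b>>)%VS.
    apply/subvP => x /b_expand ->; apply: memv_suml => i _.
    by rewrite memvZ // memv_span // mem_tnth.
  by move/dimvS/leq_trans; apply; apply: dim_span.
Qed.

Lemma dim_contr_space : \dim (contr_space r) = #|[pred p | r p == p]|.
Proof.
rewrite (@vector.size_basis _ _ _ _ _ b_basis) /m -(card_uniqP rs_uniq).
by apply: eq_card => p; rewrite mem_rs.
Qed.

Lemma contr_space_sub_diag u v :
  (contr_space r <= diag_hyperplane (rank u) (rank v))%VS = (r u == r v).
Proof.
apply/idP/eqP => [/subvP/(_ _ (bvec_in (r u)))|ruv].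
  rewrite mem_diag !bvecE eqxx; have [->//|_] := eqVneq (r v) (r u).
  by rewrite oner_eq0.
apply/subvP => x /mem_contr_space xX; rewrite mem_diag.
by rewrite xX [X in _ == X]xX ruv.
Qed.

Let restrictionP H :
  reflect (exists2 p : T * T, edge p.1 p.2 && (r p.1 != r p.2) &
             H = (diag_hyperplane (rank p.1) (rank p.2) :&: contr_space r)%VS)
          (H \in restriction A (contr_space r)).
Proof.
apply: (iffP (imfsetP _ _ _ _)) => [[H' /andP[/mem_graphic[p ep ->] np] ->]|].
  by exists p => //; rewrite ep; rewrite contr_space_sub_diag in np.
case=> p /andP[ep np] ->; exists (diag_hyperplane (rank p.1) (rank p.2)) => //.
by apply/andP; split; [apply/mem_graphic; exists p | rewrite contr_space_sub_diag].
Qed.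

(** The contracted graph, with each edge oriented towards its smaller index. *)
Let nb (i : 'I_m) : {set 'I_m} :=
  if (i < c)%N then [set j : 'I_m | (j < i)%N]
  else [set j | rho j \in r @: [set u | edge (rho i) u]].

Let nb_core (i : 'I_m) : (i < c)%N -> nb i = [set j : 'I_m | (j < i)%N].
Proof. by rewrite /nb => ->. Qed.

Let nb_noncore (i j : 'I_m) : (c <= i)%N ->
  (j \in nb i) = (rho j \in r @: [set u | edge (rho i) u]).
Proof. by rewrite /nb ltnNge => -> /=; rewrite inE. Qed.

Let noncore_nbr p u : p \notin core -> edge p u -> u \in core.
Proof. by move=> cp; apply: contraTT => cu; rewrite noncore_independent. Qed.

Let nb_free (i j : 'I_m) : (c <= i)%N -> j \in nb i -> (j < c)%N.
Proof.
move=> ci; rewrite nb_noncore // => /imsetP[u]; rewrite inE => eu ju.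
rewrite -rho_core ju contr_core //; apply: noncore_nbr eu.
by rewrite rho_core -leqNgt.
Qed.

Let nb_edge i j : j \in nb i ->
  exists u v, [/\ edge u v, r u = rho i & r v = rho j].
Proof.
have [ic|ci] := ltnP i c.
  rewrite nb_core // inE => ji; exists (rho i), (rho j); split => //.
  rewrite core_complete ?rho_core // ?(ltn_trans ji) //.
  by rewrite (inj_eq rho_inj) -val_eqE gtn_eqF.
rewrite nb_noncore // => /imsetP[v]; rewrite inE => ev jv.
by exists (rho i), v.
Qed.

Let edge_nb u v (i j : 'I_m) : edge u v -> r u = rho i -> r v = rho j -> i != j ->
  (j \in nb i) || (i \in nb j).
Proof.
have noncore_nb u' v' (i' j' : 'I_m) : (c <= i')%N -> edge u' v' -> r u' = rho i' ->
    r v' = rho j' -> j' \in nb i'.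
  move=> ci e' ui vj; rewrite nb_noncore // -vj imset_f // inE -ui.
  by rewrite contr_noncore // ui rho_core -leqNgt.
move=> euv ui vj ij.
have [ic|ci] := ltnP i c; last by rewrite (noncore_nb u v i j).
have [jc|cj] := ltnP j c.
  by rewrite !nb_core // !inE -neq_ltn eq_sym.
by rewrite orbC (noncore_nb v u j i) // edge_sym.
Qed.

Let lform_diag u v (i j : 'I_m) : r u = rho i -> r v = rho j ->
  lform b (diag_form (rank u) (rank v)) = 'X_i - 'X_j.
Proof.
move=> ui vj; rewrite /lform.
under eq_bigr do rewrite tnth_mktuple diag_formE !bvecE ui vj scalerBl.
rewrite sumrB; congr (_ - _).
  rewrite (bigD1 i) //= eqxx scale1r big1 ?addr0 // => l li.
  by rewrite (inj_eq rho_inj) eq_sym (negbTE li) scale0r.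
rewrite (bigD1 j) //= eqxx scale1r big1 ?addr0 // => l lj.
by rewrite (inj_eq rho_inj) eq_sym (negbTE lj) scale0r.
Qed.

(** [log_derivation] admits every form cutting out the hyperplane. Such a form vanishes on
    [b_i + b_j] and on the other basis vectors, so it is a multiple of ['X_i - 'X_j]. *)
Let lform_scaled u v i j (a : 'Hom('rV[K]_#|T|, K^o)) :
  r u = rho i -> r v = rho j -> i != j ->
  (lker a :&: <<b>>)%VS = (diag_hyperplane (rank u) (rank v) :&: contr_space r)%VS ->
  lform b a = (a (tnth b i) : K) *: ('X_i - 'X_j).
Proof.
move=> ui vj ij aH.
have ker x : x \in contr_space r -> x 0 (rank u) = x 0 (rank v) -> a x = 0.
  move=> xX xuv; apply/eqP; rewrite -memv_ker.
  suff : x \in (lker a :&: <<b>>)%VS by rewrite memv_cap => /andP[].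
  by rewrite aH memv_cap xX mem_diag xuv eqxx.
have aj : a (tnth b j) = - a (tnth b i).
  apply/eqP; rewrite -addr_eq0 -linearD /=; apply/eqP; apply: ker.
    by rewrite !tnth_mktuple; apply: memvD; apply: bvec_in.
  rewrite !tnth_mktuple !mxE !enum_rankK ui vj !(inj_eq rho_inj) !eqxx.
  by rewrite [j == i]eq_sym addrC.
rewrite /lform (bigD1 i) //= (bigD1 j) ?(eq_sym j) //= big1 => [|l /andP[li lj]].
  by rewrite addr0 aj scaleNr scalerBr.
rewrite ker ?scale0r // tnth_mktuple // !bvecE ui vj !(inj_eq rho_inj).
by rewrite !(eq_sym _ l) (negbTE li) (negbTE lj).
Qed.

Let log_derivation_values theta :
  log_derivation b (restriction A (contr_space r)) theta <->
  derivation theta /\ log_values nb (fun i => theta 'X_i).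
Proof.
split=> [[td tlog]|[td tval]]; split=> //.
  move=> i j ij; have [u [v [euv ui vj]]] := nb_edge ij.
  rewrite -derivationB // -(lform_diag ui vj).
  apply/dvd_diagP; rewrite -(lform_diag ui vj).
  apply: (tlog (lker (diag_form (rank u) (rank v)) :&: <<b>>)%VS) => //.
  apply/restrictionP; exists (u, v); last by rewrite (span_basis b_basis).
  rewrite euv ui vj (inj_eq rho_inj) /= -val_eqE gtn_eqF //.
  exact: nb_lt nb_core nb_free _ _ ij.
move=> H a /restrictionP[[u v] /andP[/= euv ruv] ->] aH.
have [[i ui] [j vj]] := (rho_surj u, rho_surj v).
have ij : i != j by apply: contraNneq ruv => Eij; rewrite -ui -vj Eij.
rewrite (lform_scaled (esym ui) (esym vj) ij aH) derivationZ // derivationB //.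
have [q Hq] : exists q, theta 'X_i - theta 'X_j = ('X_i - 'X_j) * q.
  case/orP: (edge_nb euv (esym ui) (esym vj) ij) => [/tval/dvd_diagP //|].
  move=> /tval/dvd_diagP[q Hq]; exists q.
  by rewrite -[LHS]opprB Hq -mulNr opprB.
by exists q; rewrite Hq scalerAl.
Qed.

Theorem free_contraction_basis :
  free_with_exponents b (restriction A (contr_space r)) (contr_exps r).
Proof.
(* [newton c nb i] has degree [#|nb i|], and [contr_exps r] lists these degrees in the order of
   [rs]. *)
have nb_card (i : 'I_m) : #|nb i| = nth 0%N (contr_exps r) i.
  have ce : c = #|[pred p in core | r p == p]| by rewrite cardE.
  rewrite /contr_exps nth_cat size_iota -ce; have [ic|ci] := ltnP i c.
    rewrite nth_iota -?ce // add0n nb_core //.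
    rewrite cardsE -sum1_card -(big_ord_widen m (fun=> 1%N)) 1?ltnW //.
    by rewrite sum1_card card_ord.
  have irn : (i - c < size rn)%N by rewrite -(ltn_add2r c) subnK // addnC -size_cat.
  rewrite (nth_map (rho i)) //.
  have -> : nth (rho i) rn (i - c) = rho i.
    by rewrite {2}/rho (tnth_nth (rho i)) /= nth_cat -/c ltnNge ci.
  rewrite -(card_imset _ rho_inj); apply: eq_card => p; apply/imsetP/idP.
    by move=> [j jn ->]; rewrite -nb_noncore.
  move=> pn; have /imsetP[u _ pu] := pn; have [j jp] := rho_surj u.
  by exists j; rewrite ?nb_noncore // jp -?pu.
have szE : size (contr_exps r) == m.
  by rewrite /contr_exps size_cat size_iota size_map cardE /m /rs size_cat.
apply/(free_with_exponentsP _ _ (Tuple szE)).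
exists (fun i => der_of (newton c nb i)); split.
- move=> i; apply/log_derivation_values; split; first exact: der_of_derivation.
  by move=> j l jl; rewrite !der_ofX; apply: newton_log nb_core nb_free _ _ _ jl.
- by move=> i j; rewrite der_ofX (tnth_nth 0%N) /= -nb_card; apply: newton_homog.
move=> eta /log_derivation_values[ed eval].
have [a [Ha Ua]] := newton_basis nb_core nb_free eval.
(* A derivation is determined by its values on the variables, so the unique expansion of tuples
   carries over. *)
have expand (a' : {ffun 'I_m -> {mpoly K[m]}}) :
    (forall p, eta p = \sum_i a' i * der_of (newton c nb i) p) <->
    (forall l, eta 'X_l = \sum_i a' i * newton c nb i l).
  split=> [E l|E]; first by rewrite E; apply: eq_bigr => i _; rewrite der_ofX.
  apply: derivation_ext => // [|l].
    by apply: derivation_comb => i; apply: der_of_derivation.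
  by rewrite E; apply: eq_bigr => i _; rewrite der_ofX.
by exists a; split=> [|a' /expand/Ua]; first exact/expand.
Qed.

Corollary free_contraction n (b' : n.-tuple 'rV[K]_#|T|) :
  basis_of (contr_space r) b' ->
  free_with_exponents b' (restriction A (contr_space r)) (contr_exps r).
Proof. by move=> b'X; apply: free_with_exponents_basis b_basis b'X free_contraction_basis. Qed.

End Free.
End Contractions.

(** * Flats of a split graph arrangement as contractions *)

Lemma mem_bigcap_seq (K : fieldType) (V : vectType K) (s : seq {vspace V}) x :
  (x \in (\bigcap_(H <- s) H)%VS) = all (fun H : {vspace V} => x \in H) s.
Proof.
by elim: s => [|H s IHs]; rewrite ?big_nil ?memvf // big_cons memv_cap IHs.
Qed.

Lemma std_basis_fullv (K : fieldType) n : basis_of fullv (@std_basis K n).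
Proof.
have dimE : dim 'rV[K]_n = n by rewrite dim_matrix; apply: mul1n.
rewrite basisEdim size_tuple dimvf dimE leqnn andbT.
apply/subvP => x _; rewrite (row_sum_delta x); apply: memv_suml => i _.
by rewrite memvZ // memv_span //; apply/tnthP; exists i; rewrite tnth_mktuple.
Qed.

Section SplitGraphFlats.
Context {K : fieldType} {T : finType} (edge : rel T) (core : pred T).
Hypothesis edge_sym : ssrbool.symmetric edge.
Hypothesis core_complete : {in core &, forall u v, edge u v = (u != v)}.
Hypothesis noncore_independent : {in [predC core] &, forall u v, edge u v = false}.

Local Notation A := (graphic_arrangement K edge).
Local Notation rank := (@enum_rank T).
Local Notation contr_space := (@contr_space K T).

(** The trivial contraction gives the whole space, and restricting to it changes nothing because no
    edge is a loop. *)
Lemma free_graphic r : r =1 id -> free_with_exponents std_basis A (contr_exps edge core r).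
Proof.
move=> rid; have id_contr : contraction core r by split=> u; rewrite !rid ?eqxx.
have fullE : contr_space r = fullv.
  apply/eqP; rewrite eqEsubv subvf; apply/subvP => x _.
  by apply/mem_contr_space => u; rewrite rid.
have := free_contraction edge_sym core_complete noncore_independent id_contr
  (b' := std_basis).
move=> /(_ K); rewrite fullE => /(_ (std_basis_fullv _ _)).
suff -> : restriction A fullv = A by [].
have idcap (H : {vspace 'rV[K]_#|T|}) : (H :&: fullv = H)%VS.
  by apply/capv_idPl/subvf.
apply/fsetP => H; apply/imfsetP/idP => [[H' /andP[H'A _] ->]|HA].
  by rewrite idcap.
exists H; rewrite ?idcap //; apply/andP; split=> //.
have [[u v] /= euv ->] := mem_graphic _ _ HA.
rewrite -fullE (contr_space_sub_diag id_contr) !rid.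
exact: edge_irr core_complete noncore_independent _ _ euv.
Qed.

Lemma flat_contraction X : flat A X -> exists2 r, contraction core r & X = contr_space r.
Proof.
case=> B /fsubsetP BA XE.
have XB H : H \in B -> (X <= H)%VS.
  move=> HB; apply/subvP => x; rewrite XE mem_bigcap_seq => /allP; exact.
pose eqv u v := (X <= diag_hyperplane (rank u) (rank v))%VS.
have eqvP u v : reflect (forall x, x \in X -> x 0 (rank u) = x 0 (rank v)) (eqv u v).
  apply: (iffP subvP) => E x /E; first by rewrite mem_diag => /eqP.
  by rewrite mem_diag => ->.
have eqv_trans u v w : eqv u v -> eqv u w = eqv v w.
  move=> /eqvP uv; apply/eqvP/eqvP => E x xX; first by rewrite -uv // E.
  by rewrite uv // E.
have eqvs u v : eqv u v = eqv v u by apply/eqvP/eqvP => E x /E.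
have eqv0 u : eqv u u by apply/eqvP.
have class_core u v : eqv u v -> u != v -> exists w, (w \in core) && eqv u w.
  move=> uv nuv; apply/existsP; apply: contraLR uv => /existsPn nc.
  have nu w : eqv u w -> w \notin core.
    by move=> uw; have := nc w; rewrite uw andbT.
  (* If the class of [u] misses the core, no hyperplane of [B] involves [u]: its other endpoint
     would be a noncore neighbour. So the unit vector at [u] lies in [X], although its entries at
     [u] and [v] differ. *)
  apply/negP => /eqvP/(_ (delta_mx 0 (rank u))); rewrite !mxE !eqxx /=.
  rewrite (inj_eq enum_rank_inj) eq_sym (negbTE nuv) => /(_ _)/eqP.
  rewrite oner_eq0 => H; apply: notF; apply: H.
  rewrite XE mem_bigcap_seq; apply/allP => H HB.
  have := XB _ HB; have [[p q] /= epq ->] := mem_graphic _ _ (BA _ HB) => pq.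
  have side p' q' : edge p' q' -> eqv p' q' -> u != p'.
    move=> e' E'; apply/eqP => up; rewrite -up in e' E'.
    by have := noncore_independent (nu _ (eqv0 u)) (nu _ E'); rewrite e'.
  rewrite mem_diag !mxE !(inj_eq enum_rank_inj) eqxx /= ![_ == u]eq_sym.
  rewrite (negbTE (side _ _ epq pq)).
  by rewrite edge_sym in epq; rewrite -/(eqv p q) eqvs in pq; rewrite (negbTE (side _ _ epq pq)).
(* The default [u] serves the classes without core vertex, which are singletons; otherwise the
   choice depends only on the class. *)
pose r u := odflt u [pick w | (w \in core) && eqv u w].
have r_eqv u : eqv u (r u) by rewrite /r; case: pickP => [w /andP[]|].
have r_class u v : eqv u v -> r u = r v.
  move=> uv; have [-> //|nuv] := eqVneq u v; rewrite /r.
  rewrite (@eq_pick _ _ (fun w => (w \in core) && eqv v w)); last first.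
    by move=> w; rewrite (eqv_trans _ _ _ uv).
  case: pickP => //= nw; have [w /andP[wc uw]] := class_core _ _ uv nuv.
  by have := nw w; rewrite wc -(eqv_trans _ _ _ uv) uw.
exists r; first split=> [u|u].
- by apply/esym/r_class.
- by rewrite /r; case: pickP => [w /andP[]|]; rewrite //= eqxx.
apply/eqP; rewrite eqEsubv; apply/andP; split; apply/subvP => x.
  by move=> xX; apply/mem_contr_space => u; apply/(eqvP u (r u)).
move=> /mem_contr_space xr; rewrite XE mem_bigcap_seq; apply/allP => H HB.
have := XB _ HB; have [[p q] /= epq ->] := mem_graphic _ _ (BA _ HB) => pq.
by rewrite mem_diag xr [X in _ == X]xr (r_class _ _ pq).
Qed.

(** Each class must be connected by edges: the core part of a class is a clique, and the hypothesis
    joins every contracted noncore vertex to it. *)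
Lemma contr_space_flat r : contraction core r ->
  (forall u, u \notin core -> r u != u ->
     exists v, [/\ v \in core, edge u v & r v = r u]) ->
  flat A (contr_space r).
Proof.
move=> r_contr nonc.
exists [fset H in A | (contr_space r <= H)%VS]%fset.
  by apply/fsubsetP => H; rewrite !inE => /andP[].
apply/eqP; rewrite eqEsubv; apply/andP; split; apply/subvP => x.
  move=> xr; rewrite mem_bigcap_seq; apply/allP => H; rewrite !inE => /andP[_].
  by move/subvP; apply.
rewrite mem_bigcap_seq => /allP xB; apply/mem_contr_space.
have xE u v : edge u v -> r u = r v -> x 0 (rank u) = x 0 (rank v).
  move=> euv ruv; apply/eqP; rewrite -mem_diag; apply: xB; rewrite !inE.
  rewrite (contr_space_sub_diag r_contr) ruv eqxx andbT.
  by apply/mem_graphic; exists (u, v).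
have xcore u : u \in core -> x 0 (rank u) = x 0 (rank (r u)).
  move=> uc; have [-> //|ru] := eqVneq (r u) u; apply: xE; last by rewrite r_contr.1.
  by rewrite core_complete ?(contr_core r_contr) // eq_sym.
move=> u; have [/xcore //|uc] := boolP (u \in core).
have [-> //|ru] := eqVneq (r u) u.
have [v [vc euv rv]] := nonc u uc ru.
by rewrite (xE _ _ euv) // xcore // rv.
Qed.

Lemma sub_contr_space r s : contraction core s -> contraction core r ->
  (contr_space r <= contr_space s)%VS -> forall u v, s u = s v -> r u = r v.
Proof.
move=> s_contr r_contr rs u v suv; apply/eqP.
rewrite -(@contr_space_sub_diag K _ _ _ r_contr); apply: subv_trans rs _.
by rewrite (contr_space_sub_diag s_contr) suv.
Qed.

Lemma contr_space_sub r s : (forall u, r (s u) = r u) ->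
  (contr_space r <= contr_space s)%VS.
Proof.
move=> rs; apply/subvP => x /mem_contr_space xr; apply/mem_contr_space => u.
by rewrite xr -rs -xr.
Qed.

Lemma count_exps a r : count_mem a (contr_exps edge core r) =
  ((a < #|[pred p in core | r p == p]|)%N +
   #|[pred p in [predC core] | (r p == p) && (#|r @: [set u | edge p u]| == a)]|)%N.
Proof.
rewrite /contr_exps count_cat count_uniq_mem ?iota_uniq // mem_iota /= add0n; congr (_ + _)%N.
rewrite count_map -size_filter cardE /enum_mem -filter_predI.
by congr size; apply: eq_filter => p; rewrite /= !inE [LHS]andbC -andbA.
Qed.

Lemma size_exps r : size (contr_exps edge core r) = #|[pred p | r p == p]|.
Proof.
rewrite /contr_exps size_cat size_iota size_map -cardE -[RHS](cardID core).
by congr (_ + _)%N; apply: eq_card => p; rewrite !inE // andbC.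
Qed.

End SplitGraphFlats.

(** * Adjacency and vertex counts in the graph G *)

Section GraphG.
Variable k : nat.

Local Notation T := (G_vertex k).
Local Notation Q4_pair := {p : 'I_4 * 'I_4 | (p.1 < p.2)%N}.
Local Notation Q4_new := {p : Q4_pair & 'I_k}.

Definition core_vertex (i : 'I_4) : T := inl (inl i).
Definition pair_vertex (w : Q4_new) : T := inl (inr w).

Definition G_core : pred T := fun v => if v is inl (inl _) then true else false.

Lemma core_vertex_inj : injective core_vertex. Proof. by move=> i j []. Qed.
Lemma pair_vertex_inj : injective pair_vertex. Proof. by move=> i j []. Qed.

Lemma G_coreP v : reflect (exists i, v = core_vertex i) (v \in G_core).
Proof.
by apply: (iffP idP) => [|[i ->] //]; case: v => [[i|w]|s] //= _; exists i.
Qed.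

Lemma G_edge_sym : ssrbool.symmetric (@G_edge k).
Proof. by case=> [[i|w]|s] [[j|w']|s'] //=; rewrite eq_sym. Qed.

Lemma G_core_complete : {in G_core &, forall u v, G_edge u v = (u != v)}.
Proof. by move=> _ _ /G_coreP[i ->] /G_coreP[j ->]; rewrite (inj_eq core_vertex_inj). Qed.

Lemma G_noncore_independent : {in [predC G_core] &, forall u v, G_edge u v = false}.
Proof. by case=> [[i|w]|s] [[j|w']|s']. Qed.

(** Core neighbours as a subset of ['I_4], where degrees can be computed. *)
Definition core_nbr (v : T) : {set 'I_4} :=
  match v with
  | inl (inl i) => [set~ i]
  | inl (inr w) => [set (val (tag w)).1; (val (tag w)).2]
  | inr _ => [set i : 'I_4 | (i < 3)%N]
  end.

Lemma nbr_noncore v : v \notin G_core ->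
  [set u | G_edge v u] = core_vertex @: core_nbr v.
Proof.
move=> vc; apply/setP => u; rewrite inE; apply/idP/imsetP.
  case: v vc => [[i|w]|s] // _; case: u => [[j|w']|s'] //= e; exists j => //.
    by rewrite !inE.
  by rewrite inE.
by case: v vc => [[i|w]|s] // _ [j]; rewrite !inE => jv -> /=.
Qed.

Lemma card_pairs : #|{: Q4_pair}| = 6.
Proof.
rewrite card_sig -sum1_card.
rewrite -(pair_big_dep xpredT (fun i j : 'I_4 => (i < j)%N) (fun _ _ => 1%N)) /=.
under eq_bigr do rewrite big_mkcond.
by rewrite !big_ord_recl !big_ord0.
Qed.

Lemma card_new : #|{: Q4_new}| = (6 * k)%N.
Proof.
rewrite card_tagged sumnE big_map big_enum /=.
by under eq_bigr do rewrite card_ord; rewrite sum_nat_const card_pairs.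
Qed.

Lemma card_new_tag (t : Q4_pair) : #|[pred w : Q4_new | tag w == t]| = k.
Proof.
have inj : injective (fun s : 'I_k => @Tagged _ t (fun=> 'I_k) s : Q4_new).
  by move=> s s' /(congr1 (fun w : Q4_new => tagged w : 'I_k)).
rewrite -[RHS]card_ord -(card_imset predT inj).
apply: eq_card => -[t' s]; rewrite !inE /=; apply/idP/idP => [/eqP ->|].
  exact: imset_f.
by case/imsetP => s' _ /(congr1 tag) /= ->.
Qed.

Lemma card_G : #|{: T}| = (7 * k + 4)%N.
Proof.
rewrite !card_sum !card_ord card_new; lia.
Qed.

End GraphG.

(** * The inclusion of flats that obstructs k-coaccuracy *)

Section NotCoaccurate.
Variable k : nat.

Local Notation T := (G_vertex k).
Local Notation Q4_pair := {p : 'I_4 * 'I_4 | (p.1 < p.2)%N}.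
Local Notation Q4_new := {p : Q4_pair & 'I_k}.
Local Notation exps := (contr_exps (@G_edge k) (@G_core k)).
Local Notation contraction := (contraction (@G_core k)).
Local Notation C := (@core_vertex k).
Local Notation W := (@pair_vertex k).

Lemma card_nbr_noncore (r : T -> T) v : v \notin G_core (k := k) ->
  #|r @: [set u | G_edge v u]| = #|[set r (C i) | i in core_nbr v]|.
Proof. by move=> /nbr_noncore ->; rewrite -imset_comp. Qed.

(** A surviving [W w] would have degree 1. The exponent 2 forces at least two core classes, which
    already supply the only exponent 1. *)
Lemma pendant_not_fixed r (t : Q4_pair) w : contraction r ->
  r (C (val t).1) = r (C (val t).2) -> count_mem 1%N (exps r) = 1%N ->
  2%N \in exps r -> tag w = t -> r (W w) != W w.
Proof.
move=> r_contr rt c1 e2 wt; apply/negP => rw.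
have : (0 < #|[pred p in [predC G_core (k := k)] | (r p == p) &&
              (#|r @: [set u | G_edge p u]| == 1%N)]|)%N.
  apply/card_gt0P; exists (W w); rewrite !inE rw card_nbr_noncore //= wt.
  by rewrite imsetU1 imset_set1 rt setUid cards1.
have := count_exps (@G_edge k) (@G_core k) 1 r; rewrite c1.
have : (1 < #|[pred p in G_core (k := k) | r p == p]|)%N; last first.
  by move=> ->; rewrite add1n => -[<-].
have := e2; rewrite mem_cat mem_iota => /orP[/= /ltnW //|/mapP[p]].
rewrite mem_enum !inE => /andP[pc _]; rewrite card_nbr_noncore // => ->.
apply: subset_leq_card; apply/subsetP => _ /imsetP[i _ ->].
by rewrite !inE (contr_core r_contr) //= r_contr.1.
Qed.

Lemma card_core_fixed r : (forall i, r (C i) = C i) ->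
  (3 < #|[pred p in G_core (k := k) | r p == p]|)%N.
Proof.
move=> rfix; have card4 : #|C @: [set: 'I_4]| = 4.
  by rewrite (card_imset _ (@core_vertex_inj k)) cardsT card_ord.
rewrite -[X in (X <= _)%N]card4.
apply: subset_leq_card; apply/subsetP => _ /imsetP[i _ ->].
by rewrite !inE /= rfix eqxx.
Qed.

(** Four surviving core vertices would contribute the exponents 0, 1, 2, 3. *)
Lemma core_not_fixed r : 3%N \notin exps r -> exists i, r (C i) != C i.
Proof.
move=> e3; apply/existsP; apply: contraNT e3 => /existsPn rfix.
rewrite mem_cat mem_iota /= add0n card_core_fixed // => i.
by apply/eqP/negPn.
Qed.

Lemma pair_of (i j : 'I_4) : i != j ->
  exists t : Q4_pair, val t = (i, j) \/ val t = (j, i).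
Proof.
rewrite -val_eqE neq_ltn => /orP[] ij.
  by exists (exist _ (i, j) ij); left.
by exists (exist _ (j, i) ij); right.
Qed.

Lemma G_no_flag_step (K : fieldType) (r s : T -> T) : (0 < k)%N ->
  contraction r -> contraction s ->
  (@contr_space K T r <= @contr_space K T s)%VS ->
  perm_eq (exps r) (0 :: 1 :: nseq (6 * k + 1) 2)%N ->
  perm_eq (exps s) (0 :: 1 :: nseq (6 * k + 1) 2 ++ [:: 3])%N -> False.
Proof.
move=> k0 r_contr s_contr rs er es.
have count_r (a : nat) : count_mem a (exps r) = _ := seq.permP er (pred1 a).
have count_s (a : nat) : count_mem a (exps s) = _ := seq.permP es (pred1 a).
have rs_eq := sub_contr_space s_contr r_contr rs.
(* Exponents count the surviving vertices, so [r] moves [k + 1] vertices and [s] moves [k]. *)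
have card_nfix (q : T -> T) : (#|[pred p | q p == p]| + #|[set p | q p != p]| = 7 * k + 4)%N.
  rewrite -card_G -(cardC [pred p | q p == p]); congr (_ + _)%N.
  by apply: eq_card => p; rewrite !inE.
have nfix_r : #|[set p | r p != p]| = k.+1.
  have := card_nfix r; rewrite -(size_exps (@G_edge k) (@G_core k)) (perm_size er) /= size_nseq.
  lia.
have nfix_s : #|[set p | s p != p]| = k.
  have := card_nfix s; rewrite -(size_exps (@G_edge k) (@G_core k)) (perm_size es) /= size_cat size_nseq /=.
  lia.
have [|i ri] := @core_not_fixed r.
  by rewrite (perm_mem er) !inE mem_nseq andbF.
have /G_coreP[j rij] := r_contr.2 _ ri.
have ij : i != j by apply: contraNneq ri => {2}->; rewrite rij.
have rj : r (C j) = C j by rewrite -rij r_contr.1.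
have [t tij] := pair_of ij.
have new_card : #|[set W w | w in [pred w : Q4_new | tag w == t]]| = k.
  by rewrite (card_imset _ (@pair_vertex_inj k)) card_new_tag.
have new_core (x : T) : x \in G_core (k := k) ->
    x \notin [set W w | w in [pred w : Q4_new | tag w == t]].
  by move=> xc; apply/negP => /imsetP[w _ xw]; rewrite xw in xc.
have sub_nfix q l : contraction q -> q (C (val t).1) = q (C (val t).2) ->
    count_mem 1%N (exps q) = 1%N -> 2%N \in exps q -> q (C l) != C l ->
    C l |: [set W w | w in [pred w : Q4_new | tag w == t]] \subset [set p | q p != p].
  move=> qc qt c1 e2 ql; apply/subsetP => p; rewrite in_setU1 inE.
  case/orP=> [/eqP->//|/imsetP[w wt ->]].
  by apply: (pendant_not_fixed qc qt c1 e2); apply/eqP.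
have count1 : count_mem 1%N (nseq (6 * k + 1) 2) = 0%N by rewrite count_nseq.
(* [C i] and its [k] pendant vertices are already [k + 1] moved vertices, so [r] moves nothing
   else. *)
have nfix_rE : C i |: [set W w | w in [pred w : Q4_new | tag w == t]] = [set p | r p != p].
  apply/eqP; rewrite eqEcard; apply/andP; split; last first.
    by rewrite cardsU1 new_core // new_card nfix_r.
  apply: sub_nfix => //.
  - by case: tij => -> /=; rewrite rij rj.
  - by rewrite count_r /= count1.
  - by rewrite (perm_mem er) !inE mem_nseq addn1.
have core_fix l : l != i -> r (C l) = C l.
  move=> li; apply/eqP; apply: contraNT li => rl.
  have : C l \in [set p | r p != p] by rewrite inE.
  rewrite -nfix_rE in_setU1 (negbTE (new_core _ _)) // orbF.
  by rewrite (inj_eq (@core_vertex_inj k)).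
(* Classes of [s] lie inside classes of [r]: if [s] sent this vertex into the core, [r] would
   too. *)
have v_fix a : s (inr a) = inr a :> T.
  have ra : r (inr a) = inr a.
    apply/eqP; apply: contraT => na.
    have : inr a \in [set p | r p != p] by rewrite inE.
    by rewrite -nfix_rE in_setU1 => /orP[//|/imsetP[w _]].
  apply/eqP; apply: contraT => /s_contr.2 sc.
  have := contr_core r_contr sc; rewrite (rs_eq (s (inr a)) (inr a)) ?ra //.
  exact: s_contr.1.
(* If [s] also identifies [i] and [j], it moves one of them and the [k] pendant vertices, one vertex
   too many. *)
have [sij|sij] := eqVneq (s (C i)) (s (C j)).
  have [l sl] : exists l, s (C l) != C l.
    have [si|] := eqVneq (s (C i)) (C i); last by exists i.
    by exists j; rewrite -sij si (inj_eq (@core_vertex_inj k)).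
  have := subset_leq_card (sub_nfix s l s_contr _ _ _ sl).
  rewrite cardsU1 new_core // new_card nfix_s ltnn => H; apply: notF; apply: H.
  - by case: tij => -> /=; rewrite sij.
  - by rewrite count_s /= count_cat count1.
  - by rewrite (perm_mem es) !inE mem_cat mem_nseq addn1.
(* Otherwise the core survives in [s], since [r] identifies no core vertices besides [i] and [j]. *)
have s_core l : s (C l) = C l.
  apply/eqP; apply: contraT => sl; have /G_coreP[l' sll'] := s_contr.2 _ sl.
  have ll' : l != l' by apply: contraNneq sl => {2}->; rewrite sll'.
  have sl'l' : s (C l') = s (C l) by rewrite -sll' s_contr.1.
  have rl'l := rs_eq _ _ sl'l'.
  have [li|li] := eqVneq l i.
    have l'i : l' != i by rewrite -li eq_sym.
    move: rl'l; rewrite (core_fix _ l'i) li rij => /core_vertex_inj l'j.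
    by rewrite -li -l'j sl'l' eqxx in sij.
  have [l'i|l'i] := eqVneq l' i.
    move: rl'l; rewrite (core_fix _ li) l'i rij => /core_vertex_inj jl.
    by rewrite -l'i jl sl'l' eqxx in sij.
  move: rl'l; rewrite !core_fix // => /core_vertex_inj El.
  by rewrite El eqxx in ll'.
(* The core accounts for the single exponent 3, yet the vertex [inr (Ordinal k0)] keeps its three
   neighbours. *)
have := count_exps (@G_edge k) (@G_core k) 3 s.
rewrite count_s /= count_cat count_nseq /= mul0n.
rewrite (card_core_fixed s_core).
rewrite /= !add0n addn0 add1n => -[/esym/card0_eq/(_ (inr (Ordinal k0)))].
rewrite !inE v_fix eqxx card_nbr_noncore //=.
rewrite (eq_imset _ s_core) (card_imset _ (@core_vertex_inj k)) cardsE.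
by rewrite -sum1_card big_mkcond !big_ord_recl big_ord0.
Qed.

End NotCoaccurate.

(** * The explicit witness and its flag *)

Section Coaccurate.
Variable k : nat.

Local Notation T := (G_vertex k).
Local Notation Q4_pair := {p : 'I_4 * 'I_4 | (p.1 < p.2)%N}.
Local Notation Q4_new := {p : Q4_pair & 'I_k}.
Local Notation exps := (contr_exps (@G_edge k) (@G_core k)).
Local Notation contraction := (contraction (@G_core k)).
Local Notation C := (@core_vertex k).
Local Notation W := (@pair_vertex k).

Definition G_exps : seq nat := 0%N :: 1%N :: nseq (6 * k + 1) 2 ++ nseq k.+1 3.

Lemma path_leq_nseq m a b s : (a <= b)%N -> path leq b s -> path leq a (nseq m b ++ s).
Proof.
elim: m a => [|m IHm] a ab bs /=; last by rewrite ab IHm.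
by case: s bs => //= c s /andP[bc ->]; rewrite (leq_trans ab bc).
Qed.

Lemma G_exps_sorted : sorted leq G_exps.
Proof.
rewrite /G_exps /= path_leq_nseq // -[nseq _ 3]cats0.
exact: path_leq_nseq.
Qed.

(* A core vertex to which a noncore vertex may be contracted. *)
Definition base (v : T) : 'I_4 :=
  match v with
  | inl (inl i) => i
  | inl (inr w) => (val (tag w)).1
  | inr _ => ord0
  end.

(** [L] lists the noncore survivors; every other vertex follows its base through the core map
    [g]. *)
Definition retract (g : 'I_4 -> 'I_4) (L : seq T) (v : T) : T :=
  if v \in L then v else C (g (base v)).

Section Retract.
Variables (g : 'I_4 -> 'I_4) (L : seq T).
Hypothesis g_idem : forall i, g (g i) = g i.
Hypothesis L_noncore : {in L, forall v, v \notin G_core (k := k)}.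

Lemma retract_core i : retract g L (C i) = C (g i).
Proof. by rewrite /retract; case: ifP => // /L_noncore. Qed.

Lemma retract_contraction : contraction (retract g L).
Proof.
have rE v : retract g L v = v \/ retract g L v = C (g (base v)).
  by rewrite /retract; case: ifP; [left | right].
split=> v; have [Ev|->] := rE v; first by rewrite !Ev.
- by rewrite retract_core g_idem.
- by rewrite Ev eqxx.
- by [].
Qed.

Lemma retract_flat (K : fieldType) :
  flat (graphic_arrangement K (@G_edge k)) (contr_space (retract g L)).
Proof.
apply: (contr_space_flat (@G_core_complete k) retract_contraction) => v vc.
rewrite {1}/retract; case: ifP => [|vL _]; first by rewrite eqxx.
exists (C (base v)); rewrite retract_core /retract vL; split=> //.
by case: v vc {vL} => [[i|w]|s] //= _; rewrite eqxx.
Qed.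

Lemma retract_fix v :
  (retract g L v == v) = (v \in L) || ((v \in G_core (k := k)) && (g (base v) == base v)).
Proof.
rewrite /retract; case: ifP => [_|_]; rewrite ?eqxx //=.
have [/G_coreP[i ->]|vc] := boolP (v \in G_core (k := k)).
  by rewrite /= (inj_eq (@core_vertex_inj k)).
by apply: contraNF vc => /eqP <-.
Qed.

(** Noncore vertices have only core neighbours, where the retraction is [g]; their degrees can be
    read off in ['I_4]. *)
Lemma retract_exps a : uniq L ->
  (forall v, v \in L -> #|[set g i | i in core_nbr v]| = a v) ->
  perm_eq (exps (retract g L)) (iota 0 #|[pred i | g i == i]| ++ map a L).
Proof.
move=> uL aL.
have -> : #|[pred i | g i == i]| = #|[pred p in G_core (k := k) | retract g L p == p]|.
  rewrite -(card_imset _ (@core_vertex_inj k)); apply: eq_card => v.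
  rewrite !inE; apply/imsetP/andP => [[i gi ->]|[/G_coreP[i ->]]].
    by rewrite retract_core (inj_eq (@core_vertex_inj k)).
  rewrite retract_core (inj_eq (@core_vertex_inj k)) => gi.
  by exists i.
rewrite /contr_exps perm_cat2l.
have mem_fix v : (v \in enum [pred p in [predC G_core (k := k)] | retract g L p == p]) = (v \in L).
  rewrite mem_enum !inE retract_fix; have [vL|vL] /= := boolP (v \in L).
    by rewrite L_noncore.
  by case: (v \in _).
have /eq_in_map -> : {in enum [pred p in [predC G_core (k := k)] | retract g L p == p],
    (fun p => #|retract g L @: [set u | G_edge p u]|) =1 a}.
  move=> v; rewrite mem_fix => vL; rewrite card_nbr_noncore ?L_noncore // -(aL _ vL).
  rewrite (eq_imset _ retract_core) imset_comp.
  by rewrite (card_imset _ (@core_vertex_inj k)).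
by apply/perm_map/uniq_perm; rewrite ?enum_uniq.
Qed.

End Retract.
Local Notation one := (Ordinal (isT : 1 < 4)%N).

Definition merge01 (i : 'I_4) : 'I_4 := if i == one then ord0 else i.

(* The d-th flat of the witness is [flat_retract d]: the core vertices are mapped
   by [flat_core d] and the noncore vertices outside [flat_new d] are contracted
   to their base. For 3 <= d <= 6k + 3 the core is the triangle obtained by
   contracting {1, 2}; for larger d nothing in the core is contracted. *)
Definition flat_core d (i : 'I_4) : 'I_4 :=
  if (d <= 1)%N then ord0
  else if d == 2 then (if i == ord_max then i else ord0)
  else if (d <= 6 * k + 3)%N then merge01 i else i.

Definition apex_new : seq T := map inr (enum 'I_k).

(** As pairs are increasing, second component [one] singles out the contracted edge {1, 2}; its [k]
    vertices are omitted. *)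
Definition triangle_new : seq T :=
  map W (enum [pred w : Q4_new | (val (tag w)).2 != one]) ++
  apex_new.

(** The triangle uses 3 dimensions, the full core with all pair vertices [6 * k + 4]. For [d <= 2]
    the truncated [d - 3] gives the empty list. *)
Definition flat_new d : seq T :=
  if (d <= 6 * k + 3)%N then take (d - 3) triangle_new
  else map W (enum {: Q4_new}) ++ take (d - (6 * k + 4)) apex_new.

Definition flat_retract d := retract (flat_core d) (flat_new d).

Lemma flat_core_idem d i : flat_core d (flat_core d i) = flat_core d i.
Proof.
rewrite /flat_core /merge01; case: (d <= 1)%N => //; case: (d == 2).
  by have [->|_] := eqVneq i ord_max; rewrite ?eqxx //; case: ifP.
case: (d <= _)%N => //; have [//|i1] := eqVneq i one.
by rewrite (negbTE i1).
Qed.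

Lemma size_apex_new : size apex_new = k.
Proof. by rewrite size_map -[RHS](card_ord k) cardE. Qed.

Lemma apex_new_uniq : uniq apex_new.
Proof. by rewrite map_inj_uniq ?enum_uniq // => a b []. Qed.

Lemma cat_new_uniq (s : seq Q4_new) (t : seq T) : uniq s ->
  subseq t apex_new -> uniq (map W s ++ t).
Proof.
move=> us ts; rewrite cat_uniq map_inj_uniq ?us /=; last exact: pair_vertex_inj.
rewrite (subseq_uniq ts apex_new_uniq) andbT; apply/hasPn => v /(mem_subseq ts).
by case/mapP => a _ ->; apply/mapP => -[].
Qed.

Lemma triangle_new_uniq : uniq triangle_new.
Proof. by apply: cat_new_uniq; rewrite ?enum_uniq. Qed.

Lemma flat_new_uniq d : uniq (flat_new d).
Proof.
rewrite /flat_new; case: ifP => _; first exact/take_uniq/triangle_new_uniq.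
by apply: cat_new_uniq; rewrite ?enum_uniq ?take_subseq.
Qed.

Lemma flat_new_noncore d : {in flat_new d, forall v, v \notin G_core (k := k)}.
Proof.
move=> v; rewrite /flat_new; case: ifP => _.
  by move/mem_take; rewrite mem_cat => /orP[] /mapP[w _ ->].
by rewrite mem_cat => /orP[/mapP[w _ ->]//|/mem_take/mapP[w _ ->]].
Qed.

Lemma size_triangle_new : size triangle_new = (6 * k)%N.
Proof.
pose t01 : Q4_pair := exist _ (ord0, one) isT.
rewrite size_cat size_apex_new size_map -cardE.
have := cardC [pred w : Q4_new | tag w == t01]; rewrite card_new_tag card_new addnC => <-.
congr (_ + _)%N; apply: eq_card => w; rewrite !inE; congr (~~ _).
apply/eqP/eqP => [w1|-> //]; apply: val_inj; have := valP (tag w).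
case: (val (tag w)) w1 => i j /= -> i1; congr pair.
by apply/val_inj/eqP; rewrite -leqn0.
Qed.

Lemma core_nbr3 s : core_nbr (inr s : T) = [set ord0; one; Ordinal (isT : 2 < 4)%N].
Proof. by apply/setP => -[[|[|[|[|m]]]] Hm]; rewrite !inE -!val_eqE. Qed.

(** Merging 1 and 2 keeps the ends of every other edge apart and reduces the neighbours 1, 2, 3 of
    an apex to two. *)
Lemma triangle_new_degree v : v \in triangle_new ->
  #|[set merge01 i | i in core_nbr v]| = 2.
Proof.
rewrite mem_cat => /orP[/mapP[w]|/mapP[s _ ->]].
  rewrite mem_enum inE => w1 ->; rewrite /= imsetU1 imset_set1 cards2.
  suff -> : merge01 (val (tag w)).1 != merge01 (val (tag w)).2 by [].
  rewrite /merge01 (negbTE w1); have ltw := valP (tag w).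
  by case: ifP => _; rewrite -val_eqE ltn_eqF // (leq_ltn_trans _ ltw).
by rewrite core_nbr3 !imsetU !imset_set1 /merge01 /= setUid cards2.
Qed.

Lemma id_degree v : v \notin G_core (k := k) ->
  #|[set i | i in core_nbr v]| = if v is inl _ then 2 else 3.
Proof.
rewrite imset_id; case: v => [[i|w]|s] // _; last first.
  by rewrite core_nbr3 setUC cardsU1 cards2 !inE.
by rewrite /= cards2 -val_eqE ltn_eqF // (valP (tag w)).
Qed.

Lemma flat_retract_exps d : (0 < d <= 7 * k + 4)%N ->
  perm_eq (exps (flat_retract d)) (take d G_exps).
Proof.
case/andP=> d0 dn.
have exps_d a := @retract_exps (flat_core d) _ (@flat_new_noncore d) a (flat_new_uniq d).
have card_fix (g : 'I_4 -> 'I_4) : #|[pred i | g i == i]| = (\sum_i (g i == i))%N.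
  by rewrite -sum1_card big_mkcond.
have deg_const (s : seq T) b : map (fun=> b) s = nseq (size s) b :> seq nat.
  by elim: s => //= v s ->.
(* In dimensions 1 and 2 only core classes survive, with exponents 0 and 0, 1. *)
have [d2|d3] := leqP d 2.
  have new0 : flat_new d = [::].
    by rewrite /flat_new (leq_trans d2) ?addn3 // (eqP (leq_trans d2 _ : d - 3 == 0)%N) ?take0.
  apply: perm_trans (exps_d (fun=> 0%N) _) _; first by rewrite new0.
  rewrite new0 card_fix !big_ord_recl big_ord0 /flat_core.
  case: d d0 d2 {exps_d new0 dn} => [|[|[|d']]] //= _ _.
  by rewrite take0.
have [dk|kd] := leqP d (6 * k + 3).
  have newE : flat_new d = take (d - 3) triangle_new by rewrite /flat_new dk.
  have coreE : flat_core d =1 merge01.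
    by move=> i; rewrite /flat_core dk leqNgt (ltnW d3) gtn_eqF.
  apply: perm_trans (exps_d (fun=> 2) _) _.
    move=> v; rewrite newE => /mem_take vt; rewrite (eq_imset _ coreE).
    exact: triangle_new_degree.
  rewrite card_fix; under eq_bigr do rewrite coreE.
  rewrite !big_ord_recl big_ord0 deg_const newE size_takel ?size_triangle_new ?leq_subLR 1?addnC //.
  have dE : d = (d - 3).+3 by lia.
  rewrite [in take d G_exps]dE.
  have : (d - 3 <= 6 * k)%N by lia.
  move: (d - 3)%N {dE} => t tk; rewrite /G_exps addn1 /= take_cat size_nseq.
  have -> : take t (nseq (6 * k) 2) = nseq t 2%N by rewrite take_nseq.
  case: ltnP => // kt; have -> : t = (6 * k)%N by lia.
  by rewrite subnn take0 cats0.
have coreE : flat_core d =1 id.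
  by move=> i; rewrite /flat_core leqNgt (ltnW d3) gtn_eqF // leqNgt kd.
apply: perm_trans (exps_d (fun v => if v is inl _ then 2 else 3)%N _) _.
  move=> v /flat_new_noncore vc; rewrite (eq_imset _ coreE); exact: id_degree.
have -> : #|[pred i | flat_core d i == i]| = 4.
  by rewrite -[4]card_ord; apply: eq_card => i; rewrite !inE coreE eqxx.
rewrite /flat_new leqNgt kd /= map_cat map_take.
set f := fun v : T => _.
have -> : map f (map W (enum {: Q4_new})) = nseq (6 * k) 2.
  by rewrite -map_comp -card_new cardE; elim: (enum _) => //= w s ->.
have -> : map f apex_new = nseq k 3.
  rewrite -[in RHS]size_apex_new /apex_new size_map -map_comp.
  by elim: (enum _) => //= w s ->.
have dE : d = (d - (6 * k + 4) + 6 * k).+4 by lia.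
rewrite [in take d G_exps]dE; have : (d - (6 * k + 4) <= k)%N by lia.
move: (d - (6 * k + 4))%N {dE} => t tk; rewrite take_nseq //.
have -> : take (t + 6 * k).+4 G_exps =
    [:: 0, 1 & 2 :: nseq (6 * k) 2 ++ 3 :: nseq t 3]%N.
  rewrite /G_exps addn1 /= take_cat size_nseq ltnNge.
  have -> : (6 * k <= (t + 6 * k).+1)%N by lia.
  by rewrite -addSn addnK /= take_nseq.
(* The core now contributes its own 3, ahead of the block of twos from the pair vertices; moving it
   past that block gives the sorted order. *)
rewrite /= !perm_cons -[3 :: nseq (6 * k) 2 ++ _]cat1s -[3 :: nseq t 3]cat1s.
by rewrite perm_catCA.
Qed.

Lemma flat_retract_contraction d : contraction (flat_retract d).
Proof. exact: retract_contraction (@flat_core_idem d) (@flat_new_noncore d). Qed.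

Lemma size_G_exps : size G_exps = (7 * k + 4)%N.
Proof. by rewrite /G_exps /= size_cat /= !size_nseq; lia. Qed.

Lemma flat_core_comp c d i : (0 < c <= d)%N ->
  flat_core c (flat_core d i) = flat_core c i.
Proof.
case/andP=> c0 cd; rewrite /flat_core.
have [//|c1] := leqP c 1; rewrite (leqNgt d) (leq_trans c1 cd) /=.
have [c2|c2] := eqVneq c 2.
  have [//|d2] := eqVneq d 2; first by have [->|_] := eqVneq i ord_max; rewrite ?eqxx //; case: ifP.
  by case: (d <= _)%N => //; rewrite /merge01; have [->|] := eqVneq i one.
have -> : (d == 2) = false by lia.
case: (leqP d) => dk; case: (leqP c) => ck //; last by lia.
by rewrite /merge01; have [//|i1] := eqVneq i one; rewrite (negbTE i1).
Qed.

(** Up to this bound the survivor lists are prefixes of one list. In dimension [6 * k + 4] the apex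
    vertices, all present one dimension below, are contracted, and the nesting stops. *)
Lemma flat_retract_comp c d v : (0 < c <= d)%N -> (d <= 6 * k + 3)%N ->
  flat_retract c (flat_retract d v) = flat_retract c v.
Proof.
move=> cd dk; have ck : (c <= 6 * k + 3)%N by lia.
have cd3 : (c - 3 <= d - 3)%N by lia.
rewrite {2}/flat_retract /retract; case: ifP => // vd.
rewrite /flat_retract (retract_core _ (@flat_new_noncore c)) flat_core_comp //.
rewrite /retract ifF //; apply: contraFF vd; rewrite /flat_new ck dk.
by rewrite -(subnK cd3) addnC takeD mem_cat => ->.
Qed.

Lemma flat_retract_id : flat_retract (7 * k + 4) =1 id.
Proof.
move=> v; rewrite /flat_retract /retract /flat_new /flat_core.
have -> : (7 * k + 4 <= 6 * k + 3)%N = false by lia.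
have -> : (7 * k + 4 <= 1)%N = false by lia.
have -> : (7 * k + 4 == 2)%N = false by lia.
have -> : (7 * k + 4 - (6 * k + 4))%N = k by lia.
rewrite take_oversize ?size_apex_new // mem_cat.
case: v => [[i|w]|s] /=; case: ifP => //.
  by rewrite (mem_map (@pair_vertex_inj k)) mem_enum.
by rewrite orbC /apex_new mem_map ?mem_enum // => a b [].
Qed.

Lemma flat_retract_witness (K : fieldType) :
  accuracy_witness (graphic_arrangement K (@G_edge k)) G_exps
    (fun d => contr_space (flat_retract d)).
Proof.
move=> d dn; have {}dn : (0 < d <= 7 * k + 4)%N by rewrite -card_G.
have pd := flat_retract_exps dn; split.
- exact: retract_flat (@flat_core_idem d) (@flat_new_noncore d) _.
- rewrite (dim_contr_space (flat_retract_contraction d)).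
  rewrite -(size_exps (@G_edge k) (@G_core k)) (perm_size pd) size_takel //.
  by rewrite size_G_exps; case/andP: dn.
rewrite perm_sym in pd; apply: (free_with_exponents_perm pd).
apply: (free_contraction (@G_edge_sym k) (@G_core_complete k)
  (@G_noncore_independent k) (flat_retract_contraction d)).
exact: vbasisP.
Qed.

Lemma G_free (K : fieldType) :
  free_with_exponents std_basis (graphic_arrangement K (@G_edge k)) G_exps.
Proof.
have pn : perm_eq G_exps (exps (flat_retract (7 * k + 4))).
  rewrite perm_sym -[X in perm_eq _ X]take_size size_G_exps.
  by apply: flat_retract_exps; lia.
apply: (free_with_exponents_perm pn).
exact: free_graphic (@G_edge_sym k) (@G_core_complete k)
  (@G_noncore_independent k) _ flat_retract_id.
Qed.

End Coaccurate.

(** * Coaccuracy from the explicit flag, and its failure one step higher *)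

Theorem theorem6p12 (K : fieldType) (k : nat) (hk : (1 <= k)%N) :
  coaccurate k.+1 (graphic_arrangement K (@G_edge k)) /\
  ~ coaccurate k (graphic_arrangement K (@G_edge k)).
Proof.
split.
  exists (G_exps k), (fun d => contr_space (@flat_retract k d)).
  split; [exact: G_free | exact: G_exps_sorted | exact: flat_retract_witness |].
  (* The bound [n - (k + 1)] equals [6 * k + 3], exactly the range in which the flats are nested. *)
  move=> c d cd; move=> dn; have {}dn : (d <= 7 * k + 4 - k.+1)%N by rewrite -card_G.
  apply: contr_space_sub => v.
  apply: flat_retract_comp => //; lia.
case=> e [X [efree esorted eX Xsub]].
(* Exponents are unique up to order, and both lists are sorted. *)
have eE : e = G_exps k.
  apply: (sorted_eq leq_trans anti_leq esorted (G_exps_sorted k)).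
  exact: free_exponents_unique efree (G_free k K).
have flatX d : (0 < d <= 7 * k + 4)%N -> exists r, [/\ contraction (@G_core k) r,
    X d = contr_space r & perm_eq (contr_exps (@G_edge k) (@G_core k) r) (take d (G_exps k))].
  move=> dn; have [] := eX d _; first by rewrite card_G.
  move=> /(flat_contraction (@G_edge_sym k) (@G_noncore_independent k))[r rc Xr] _.
  rewrite eE => Xfree; exists r; split=> //.
  apply: free_exponents_unique Xfree; rewrite Xr.
  apply: (free_contraction (@G_edge_sym k) (@G_core_complete k)
    (@G_noncore_independent k) rc).
  exact: vbasisP.
(* A flag up to [n - k = 6 * k + 4] contains the excluded inclusion between its top two members. *)
have [|r [rc Xr er]] := flatX (6 * k + 3)%N; first by lia.
have [|s [sc Xs es]] := flatX (6 * k + 4)%N; first by lia.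
apply: (G_no_flag_step (K := K) hk rc sc).
- by rewrite -Xr -Xs; apply: Xsub; rewrite ?card_G; lia.
- move: er; rewrite (_ : 6 * k + 3 = (6 * k + 1).+2)%N /=; last by lia.
  by rewrite take_size_cat ?size_nseq.
(* One step past the block of [6 * k + 1] twos, the prefix takes in exactly one 3. *)
move: es; rewrite (_ : 6 * k + 4 = (6 * k + 1 + 1).+2)%N /=; last by lia.
by rewrite take_cat size_nseq ltnNge leq_addr /= addKn /= take0.
Qed.
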